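(* Let $f$ be the metric coefficient of a spacetime in class $\mathcal{S}_{\text{ext}}$, $v(r):=f(r)/r^2$, and let $0<\lambda^2<\lambda_*^2:=v(r_* )$. Let $r_H<r_\lambda<r_*<R_\lambda<\infty$ be the unique radii with $v(r_\lambda)=v(R_\lambda)=\lambda^2$. Consider the photon surface ODE $$\Big(\frac{dr}{dt}\Big)^2=\frac{f(r)^2\,(\lambda^2r^2-f(r))}{\lambda^2r^2}.\qquad(\ast)$$ Then there exist unique smooth, time-symmetric global solutions $r_{r_\lambda}$ and $r_{R_\lambda}$ of $(\ast)$ with this $\lambda^2$ and $r(0)=r_\lambda$ and $r(0)=R_\lambda$, respectively. Moreover, for any initial value $r_H<r_0<r_\lambda$ or $R_\lambda<r_0<\infty$, there exist precisely two smooth, global solutions of $(\ast)$ with this $\lambda^2$ and $r(0)=r_0$; these are time-reflections of each other and time-translations and possibly time-reflections of $r_{r_\lambda}$ or $r_{R_\lambda}$, respectively. Solving the initial value problem for $(\ast)$ at generic $t_0$ rather than at $t_0=0$ results only in further time-translations. All these solutions behave as follows (up to the time-translations and time-reflections just described): $r_{r_\lambda}$ is strictly increasing on $(-\infty,0)$, strictly decreasing on $(0,\infty)$, and tends to $r_H$ as $t\to\pm\infty$; $r_{R_\lambda}$ is strictly decreasing on $(-\infty,0)$, strictly increasing on $(0,\infty)$, and tends to $\infty$ as $t\to\pm\infty$.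
   Context: Class $\mathcal{S}$: Lorentzian manifolds $(\mathbb{R}\times\mathcal{I}\times\mathbb{S}^{n-1},\ -f(r)dt^2+\frac{1}{f(r)}dr^2+r^2\Omega)$ with $\mathcal{I}\subseteq(0,\infty)$ an open interval, $f\colon\mathcal{I}\to(0,\infty)$ smooth (the metric coefficient), $\Omega$ the round metric on $\mathbb{S}^{n-1}$. Class $\mathcal{S}_{\text{ext}}$: those members of $\mathcal{S}$ for which $\mathcal{I}=(r_H,\infty)$ for some $r_H>0$ and: (1) $f$ extends $C^3$ to $r_H$ with $f(r_H)=0$, $f'(r_H)>0$; (2) $f(r)\to1$ and $f'(r)\to0$ as $r\to\infty$; (3) $v(r)=f(r)/r^2$ is strictly increasing on $(r_H,r_* )$ up to one global maximum at some $r_*\in\mathcal{I}$ and then strictly decreasing on $(r_*,\infty)$. Solutions $r=r(t)$ take values in $(r_H,\infty)$; global means defined for all $t\in\mathbb{R}$; time-symmetric means $r(-t)=r(t)$. A time-translation of a function $r(t)$ is $t\mapsto r(t+c)$, $c\in\mathbb{R}$; its time-reflection is $t\mapsto r(-t)$.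
   Formalization: Uniqueness of the time-symmetric solutions is among non-constant ones, since the constants r_λ and R_λ also solve (∗); and v' ≠ 0 is assumed at r_λ and R_λ, since otherwise no non-constant solution reaches that radius in finite time. *)

(* Defs.v *)
From Stdlib Require Import Reals.
From Coquelicot Require Import Coquelicot.
Open Scope R_scope.

Definition Rbar_open_interval (a b : Rbar) (x : R) : Prop :=
  Rbar_lt a x /\ Rbar_lt x b.

(* The set [D] is meant to be open, so that two-sided derivatives are the right
   notion. *)
Definition C_k_on (k : nat) (D : R -> Prop) (f : R -> R) : Prop :=
  (forall n x, (n <= k)%nat -> D x -> ex_derive_n f n x) /\
  (forall x, D x -> continuous (Derive_n f k) x).

Definition smooth_on (D : R -> Prop) (f : R -> R) : Prop :=
  forall n x, D x -> ex_derive_n f n x.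

Definition smooth (r : R -> R) : Prop := smooth_on (fun _ => True) r.

Definition strictly_increasing_on (D : R -> Prop) (f : R -> R) : Prop :=
  forall x y, D x -> D y -> x < y -> f x < f y.

Definition strictly_decreasing_on (D : R -> Prop) (f : R -> R) : Prop :=
  forall x y, D x -> D y -> x < y -> f y < f x.

(* [f] is the metric coefficient of the spacetime with line element
   - f dt^2 + dr^2 / f + r^2 Omega and radial interval (a, b); a spacetime of
   this form is determined by its dimension, (a, b) and the restriction of [f]
   to (a, b).  The values of [f] outside (a, b) are irrelevant. *)
Definition class_S (a b : Rbar) (f : R -> R) : Prop :=
  Rbar_le 0 a /\ Rbar_lt a b /\
  smooth_on (Rbar_open_interval a b) f /\
  (forall r, Rbar_open_interval a b r -> 0 < f r).

Definition v (f : R -> R) (r : R) : R := f r / r ^ 2.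

(* [f] need not itself be regular at [rH], where its value is arbitrary, so the
   C^3 extension to [rH] is a separate function [g]: as usual on a half-closed
   interval, one that is C^3 on an open neighbourhood of [rH, oo). *)
Definition C3_extends_to_horizon (f : R -> R) (rH : R) : Prop :=
  exists (g : R -> R) (a : R),
    a < rH /\
    (forall r, rH < r -> g r = f r) /\
    C_k_on 3 (Rbar_open_interval a p_infty) g /\
    g rH = 0 /\ 0 < Derive g rH.

Definition class_S_ext (f : R -> R) (rH rstar : R) : Prop :=
  0 < rH /\
  class_S rH p_infty f /\
  C3_extends_to_horizon f rH /\
  is_lim f p_infty 1 /\
  is_lim (Derive f) p_infty 0 /\
  rH < rstar /\
  strictly_increasing_on (Rbar_open_interval rH rstar) (v f) /\
  (forall r, rH < r -> r <> rstar -> v f r < v f rstar) /\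
  strictly_decreasing_on (Rbar_open_interval rstar p_infty) (v f).

(* Strict monotonicity of [v f] alone allows critical points away from the
   maximum.  On a level set of [v f] through such a point, the right-hand side
   of the photon surface equation has a degenerate zero, which non-constant
   solutions do not reach in finite time. *)
Definition regular_value (f : R -> R) (rH c : R) : Prop :=
  forall r, rH < r -> v f r = c -> Derive (v f) r <> 0.

Definition global_solution (f : R -> R) (rH lambda : R) (r : R -> R) : Prop :=
  smooth r /\
  (forall t, rH < r t) /\
  (forall t, (Derive r t) ^ 2 =
     (f (r t)) ^ 2 * (lambda ^ 2 * (r t) ^ 2 - f (r t))
     / (lambda ^ 2 * (r t) ^ 2)).

(* Where [v f] takes the value lambda^2, the constant function is a smooth,
   time-symmetric, global solution as well. *)
Definition nonconstant (r : R -> R) : Prop := exists s t, r s <> r t.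

Definition time_symmetric (r : R -> R) : Prop := forall t, r (- t) = r t.

Definition time_translation (c : R) (r : R -> R) : R -> R := fun t => r (t + c).

Definition time_reflection (r : R -> R) : R -> R := fun t => r (- t).

Definition translate_or_reflect (r s : R -> R) : Prop :=
  exists c, s = time_translation c r \/ s = time_translation c (time_reflection r).

Definition two_solutions (f : R -> R) (rH lambda r0 : R) (r : R -> R) : Prop :=
  exists s1 s2 : R -> R,
    s1 <> s2 /\
    (forall s, (global_solution f rH lambda s /\ s 0 = r0) <-> (s = s1 \/ s = s2)) /\
    s2 = time_reflection s1 /\
    translate_or_reflect r s1 /\ translate_or_reflect r s2.

(* Main.v *)
Require Import Defs.
From Stdlib Require Import Reals Lra Lia FunctionalExtensionality ClassicalEpsilon.
From Coquelicot Require Import Coquelicot.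
Open Scope R_scope.

(* Write the equation as r'^2 = F(r) with F = f^2 (1 - v / lambda^2).  F is
   negative exactly between the two radii, so a solution stays on one side, where
   the radius e is a simple zero of F.

   Existence: with r = e + u^2 (or e - u^2), the equation becomes the regular
   autonomous equation u' = sqrt (h u) / 2 where F(e + u^2) = u^2 h(u), solved by
   inverting the travel time.  The travel time to the end of the interval is
   infinite since F = O((r - r_H)^2) at the horizon and F is bounded at infinity,
   so the solution is global.

   Uniqueness: a smooth non-constant solution also satisfies r'' = F'(r) / 2,
   which determines it from its initial position and velocity; the equation fixes
   the velocity up to sign, and both signs occur along the even solution. *)

(** * Differentiability to finite order *)

(** The equation alone does not determine its solutions. Since [sqrt F] is not Lipschitz at [e], a
    solution may rest at [e] for a while and then leave. Such glued curves are C^1, but their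
    acceleration jumps by [F'(e) / 2]. Smoothness excludes them as soon as [F'(e) <> 0], and this is
    what [regular_value] supplies: on the level set, [F' = - (f^2 / lambda^2) v']. The constant [e]
    survives, hence the restriction to non-constant solutions. The simple zero also shapes the
    existence proof. The travel time in the variable [u] has the continuous even integrand
    [2 / sqrt (h u)]; its inverse is therefore odd and the square of that inverse even, which gives
    time symmetry. As [h] is only known to be continuous, the inversion yields one derivative, and
    smoothness of [r] is recovered afterwards from the second-order equation. Both regions are
    instances of one construction, which starts at the left end of an interval and runs to the
    right; the inner region fits after the change of coordinate [y = - r]. *)

Definition differentiable_upto (n : nat) (D : R -> Prop) (f : R -> R) : Prop :=
  forall m x, (m <= n)%nat -> D x -> ex_derive_n f m x.

Lemma Derive_n_Derive (f : R -> R) (n : nat) (x : R) :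
  Derive_n (Derive f) n x = Derive_n f (S n) x.
Proof.
  replace (S n) with (n + 1)%nat by lia.
  apply (Derive_n_comp f n 1).
Qed.

Lemma ex_derive_n_Derive (f : R -> R) (n : nat) (x : R) :
  ex_derive_n (Derive f) (S n) x <-> ex_derive_n f (S (S n)) x.
Proof.
  change (ex_derive (Derive_n (Derive f) n) x <-> ex_derive (Derive_n f (S n)) x).
  split; apply ex_derive_ext; intro t; [|symmetry]; apply Derive_n_Derive.
Qed.

(** Peeling off one derivative turns each closure property into an induction on the order: the
    derivative of a product, inverse or composite involves the functions themselves only to order
    [n]. Smoothness as such offers nothing to induct on, hence the finite orders. *)
Lemma differentiable_upto_S (n : nat) (D : R -> Prop) (f : R -> R) :
  differentiable_upto (S n) D f <->
  (forall x, D x -> ex_derive f x) /\ differentiable_upto n D (Derive f).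
Proof.
  split.
  - intros H; split.
    + intros x Dx; exact (H 1%nat x ltac:(lia) Dx).
    + intros [|m] x Hm Dx; [exact I|].
      apply (ex_derive_n_Derive f m x), H; [lia|exact Dx].
  - intros [H1 H] [|[|m]] x Hm Dx; [exact I|exact (H1 x Dx)|].
    apply (proj1 (ex_derive_n_Derive f m x)), H; [lia|exact Dx].
Qed.

Lemma differentiable_upto_le (n m : nat) (D : R -> Prop) (f : R -> R) :
  (m <= n)%nat -> differentiable_upto n D f -> differentiable_upto m D f.
Proof. intros Hmn H k x Hk Dx; apply H; [lia|exact Dx]. Qed.

Lemma differentiable_upto_ext (n : nat) (D : R -> Prop) (f g : R -> R) :
  open D -> (forall x, D x -> f x = g x) ->
  differentiable_upto n D f -> differentiable_upto n D g.
Proof.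
  intros oD E H m x Hm Dx.
  apply ex_derive_n_ext_loc with f; [|now apply H].
  apply filter_imp with (2 := oD x Dx); exact E.
Qed.

Lemma differentiable_upto_const (n : nat) (D : R -> Prop) (c : R) :
  differentiable_upto n D (fun _ => c).
Proof.
  intros m x _ _.
  apply ex_derive_n_const.
Qed.

Lemma differentiable_upto_id (n : nat) (D : R -> Prop) :
  differentiable_upto n D (fun x => x).
Proof.
  apply differentiable_upto_le with (S n); [lia|].
  apply differentiable_upto_S; split; [intros x _; apply ex_derive_id|].
  replace (Derive (fun x => x)) with (fun _ : R => 1).
  { apply differentiable_upto_const. }
  apply functional_extensionality; intro x; symmetry; apply Derive_id.
Qed.

Lemma differentiable_upto_plus (n : nat) (D : R -> Prop) (f g : R -> R) :
  open D -> differentiable_upto n D f -> differentiable_upto n D g ->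
  differentiable_upto n D (fun x => f x + g x).
Proof.
  intros oD Hf Hg m x Hm Dx.
  apply ex_derive_n_plus; apply filter_imp with (2 := oD x Dx);
    intros y Dy k Hk; [apply Hf|apply Hg]; try exact Dy; lia.
Qed.

Lemma differentiable_upto_opp (n : nat) (D : R -> Prop) (f : R -> R) :
  differentiable_upto n D f -> differentiable_upto n D (fun x => - f x).
Proof.
  intros Hf m x Hm Dx.
  now apply ex_derive_n_opp, Hf.
Qed.

Lemma differentiable_upto_minus (n : nat) (D : R -> Prop) (f g : R -> R) :
  open D -> differentiable_upto n D f -> differentiable_upto n D g ->
  differentiable_upto n D (fun x => f x - g x).
Proof.
  intros oD Hf Hg.
  apply differentiable_upto_plus; [exact oD|exact Hf|].
  now apply differentiable_upto_opp.
Qed.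

Lemma differentiable_upto_mult (n : nat) (D : R -> Prop) (f g : R -> R) :
  open D -> differentiable_upto n D f -> differentiable_upto n D g ->
  differentiable_upto n D (fun x => f x * g x).
Proof.
  intros oD; revert f g; induction n as [|n IH]; intros f g Hf Hg.
  { intros m x Hm _; replace m with 0%nat by lia; exact I. }
  pose proof (differentiable_upto_le (S n) n _ _ ltac:(lia) Hf) as Hf0.
  pose proof (differentiable_upto_le (S n) n _ _ ltac:(lia) Hg) as Hg0.
  apply differentiable_upto_S in Hf as [f1 Hf].
  apply differentiable_upto_S in Hg as [g1 Hg].
  apply differentiable_upto_S; split.
  { intros x Dx; apply ex_derive_mult; auto. }
  apply differentiable_upto_ext with (fun x => Derive f x * g x + f x * Derive g x);
    [exact oD| |].
  { intros x Dx; symmetry; apply Derive_mult; auto. }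
  apply differentiable_upto_plus; auto.
Qed.

Lemma differentiable_upto_inv (n : nat) (D : R -> Prop) (f : R -> R) :
  open D -> (forall x, D x -> f x <> 0) -> differentiable_upto n D f ->
  differentiable_upto n D (fun x => / f x).
Proof.
  intros oD nz; induction n as [|n IH]; intros Hf.
  { intros m x Hm _; replace m with 0%nat by lia; exact I. }
  pose proof (differentiable_upto_le (S n) n _ _ ltac:(lia) Hf) as Hf0.
  apply differentiable_upto_S in Hf as [f1 Hf].
  apply differentiable_upto_S; split.
  { intros x Dx; apply ex_derive_inv; auto. }
  apply differentiable_upto_ext with (fun x => - Derive f x * (/ f x * / f x));
    [exact oD| |].
  { intros x Dx; rewrite Derive_inv by auto; field; auto. }
  apply (differentiable_upto_mult n D (fun x => - Derive f x)); [exact oD| |].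
  2: { apply (differentiable_upto_mult n D (fun x => / f x)); auto. }
  now apply differentiable_upto_opp.
Qed.

Lemma differentiable_upto_comp (n : nat) (D E : R -> Prop) (g f : R -> R) :
  open E -> (forall x, E x -> D (f x)) ->
  differentiable_upto n D g -> differentiable_upto n E f ->
  differentiable_upto n E (fun x => g (f x)).
Proof.
  (* The outer function varies in the induction: the chain rule calls for the hypothesis with
     [Derive g] in place of [g]. *)
  intros oE DE; revert g; induction n as [|n IH]; intros g Hg Hf.
  { intros m x Hm _; replace m with 0%nat by lia; exact I. }
  pose proof (differentiable_upto_le (S n) n _ _ ltac:(lia) Hf) as Hf0.
  apply differentiable_upto_S in Hf as [f1 Hf].
  apply differentiable_upto_S in Hg as [g1 Hg].
  apply differentiable_upto_S; split.
  { intros x Dx; apply ex_derive_comp; auto. }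
  apply differentiable_upto_ext with (fun x => Derive f x * Derive g (f x));
    [exact oE| |].
  { intros x Dx; symmetry; apply Derive_comp; auto. }
  apply differentiable_upto_mult; auto.
Qed.

Lemma smooth_on_Derive (D : R -> Prop) (f : R -> R) :
  smooth_on D f -> smooth_on D (Derive f).
Proof.
  intros H n x Dx.
  assert (K : differentiable_upto (S n) D f) by (intros m y _ Dy; now apply H).
  apply differentiable_upto_S in K as [_ K].
  now apply (K n).
Qed.

(* Every derivative of [w] gained on the left-hand side feeds the right-hand
   side. *)
Lemma second_order_solution_smooth (D : R -> Prop) (G w p : R -> R) :
  smooth_on D G -> (forall t, D (w t)) ->
  (forall t, is_derive w t (p t)) -> (forall t, is_derive p t (G (w t))) ->
  smooth w.
Proof.
  intros HG Dw Hw Hp.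
  assert (Ew : Derive w = p).
  { apply functional_extensionality; intro t; now apply is_derive_unique. }
  assert (Ep : Derive p = fun t => G (w t)).
  { apply functional_extensionality; intro t; now apply is_derive_unique. }
  assert (K : forall n, differentiable_upto n (fun _ => True) w).
  { induction n as [|n IH].
    { intros m x Hm _; replace m with 0%nat by lia; exact I. }
    apply differentiable_upto_le with (S (S n)); [lia|].
    apply differentiable_upto_S; split; [intros t _; now exists (p t)|].
    rewrite Ew; apply differentiable_upto_S; split.
    { intros t _; now exists (G (w t)). }
    rewrite Ep.
    apply differentiable_upto_comp with D; auto.
    { apply open_true. }
    intros m x _; apply HG. }
  intros n x _; exact (K n n x (le_n n) I).
Qed.

(** * Second-order equations *)

(** The results of [auto_derive] contain derivatives of eta-expanded functions, which have to be
    contracted before rewriting. *)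
Ltac rewrite_derive H :=
  match type of H with
  | is_derive ?f ?x ?l =>
      change (Derive (fun y : R => f y) x) with (Derive f x);
      rewrite (is_derive_unique f x l H)
  end.

Lemma is_derive_continuous (f : R -> R) (x l : R) :
  is_derive f x l -> continuous f x.
Proof. intros H; apply (ex_derive_continuous f x); now exists l. Qed.

(** * Mean values, intermediate values and bounds on segments *)

Lemma mean_value (f df : R -> R) (a b : R) :
  a <= b -> (forall x, a <= x <= b -> is_derive f x (df x)) ->
  exists c, a <= c <= b /\ f b - f a = df c * (b - a).
Proof.
  intros Hab H.
  destruct (MVT_gen f a b df) as [c Hc];
    rewrite ?Rmin_left, ?Rmax_right in * by exact Hab.
  - intros x Hx; apply H; lra.
  - intros x Hx; apply continuity_pt_filterlim.
    exact (is_derive_continuous _ _ _ (H x Hx)).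
  - now exists c.
Qed.

Lemma derive_nonneg_le (f df : R -> R) (a b : R) :
  a <= b -> (forall x, a <= x <= b -> is_derive f x (df x)) ->
  (forall x, a <= x <= b -> 0 <= df x) -> f a <= f b.
Proof.
  intros Hab H Hd.
  destruct (mean_value f df a b Hab H) as (c & Hc & E).
  pose proof (Rmult_le_pos (df c) (b - a) (Hd c Hc) ltac:(lra)).
  lra.
Qed.

Lemma derive_pos_lt (f df : R -> R) (a b : R) :
  a < b -> (forall x, a <= x <= b -> is_derive f x (df x)) ->
  (forall x, a <= x <= b -> 0 < df x) -> f a < f b.
Proof.
  intros Hab H Hd.
  destruct (mean_value f df a b ltac:(lra) H) as (c & Hc & E).
  pose proof (Rmult_lt_0_compat (df c) (b - a) (Hd c Hc) ltac:(lra)).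
  lra.
Qed.

Lemma derive_zero_const (f : R -> R) :
  (forall x, is_derive f x 0) -> forall x y, f x = f y.
Proof.
  intros H.
  assert (K : forall x y, x <= y -> f x = f y).
  { intros x y Hxy.
    destruct (mean_value f (fun _ => 0) x y Hxy) as (c & _ & E); [auto|lra]. }
  intros x y; destruct (Rle_dec x y); [auto|symmetry; apply K; lra].
Qed.

Lemma intermediate_value (f : R -> R) (a b y : R) :
  a <= b -> (forall x, a <= x <= b -> continuous f x) ->
  f a <= y <= f b -> exists x, a <= x <= b /\ f x = y.
Proof.
  intros Hab Hf Hy.
  destruct (Req_dec (f a) y) as [E|Na]; [exists a; split; [lra|exact E]|].
  destruct (Req_dec (f b) y) as [E|Nb]; [exists b; split; [lra|exact E]|].
  assert (a <> b) by (intros ->; lra).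
  destruct (Ranalysis5.IVT_interv (fun x => f x - y) a b) as (x & Hx & E); try lra.
  - intros x Hx; apply continuity_pt_minus.
    + now apply continuity_pt_filterlim, Hf.
    + apply continuity_pt_const; intros ? ?; reflexivity.
  - exists x; split; [exact Hx|lra].
Qed.

Lemma intermediate_value_global (f : R -> R) (a b y : R) :
  (forall x, continuous f x) -> f a <= y <= f b -> exists x, f x = y.
Proof.
  intros Hf Hy.
  destruct (IVT_gen f a b y) as (x & _ & E).
  - intro x; apply continuity_pt_filterlim, Hf.
  - rewrite Rmin_left, Rmax_right; lra.
  - now exists x.
Qed.

Lemma bounded_on_segment (f : R -> R) (a b : R) :
  a <= b -> (forall x, a <= x <= b -> continuous f x) ->
  exists M, forall x, a <= x <= b -> Rabs (f x) <= M.
Proof.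
  intros Hab Hf.
  destruct (continuity_ab_maj (fun x => Rabs (f x)) a b Hab) as (m & Hm & _).
  - intros x Hx; apply continuity_pt_filterlim.
    apply (continuous_Rabs_comp f x), Hf, Hx.
  - now exists (Rabs (f m)).
Qed.

(** The product [E x * exp (- C * x)] does not increase, so it is at most 0 at [b]. *)
Lemma gronwall_zero (E dE : R -> R) (C a b : R) :
  a <= b -> (forall x, a <= x <= b -> is_derive E x (dE x)) ->
  (forall x, a <= x <= b -> dE x <= C * E x) ->
  0 <= E b -> E a = 0 -> E b = 0.
Proof.
  intros Hab HE HC Pb Za.
  assert (K : - (E a * exp (- C * a)) <= - (E b * exp (- C * b))).
  { apply (derive_nonneg_le (fun x => - (E x * exp (- C * x)))
      (fun x => (C * E x - dE x) * exp (- C * x))); [exact Hab| |].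
    - intros x Hx; pose proof (HE x Hx) as D.
      evar_last; [auto_derive; [now exists (dE x)|reflexivity]|].
      rewrite_derive D; ring.
    - intros x Hx; apply Rmult_le_pos; [|left; apply exp_pos].
      specialize (HC x Hx); lra. }
  rewrite Za in K.
  pose proof (exp_pos (- C * b)).
  nra.
Qed.

(** * Uniqueness for second-order equations *)

(** Over a compact time interval a trajectory keeps away from [A] and [B], so a single Lipschitz
    constant of [G] serves along it. *)
Lemma continuous_range_segment (w : R -> R) (A B : Rbar) (a b : R) :
  a <= b -> (forall t, a <= t <= b -> continuous w t) ->
  (forall t, a <= t <= b -> Rbar_open_interval A B (w t)) ->
  exists m M : R, Rbar_lt A m /\ Rbar_lt M B /\ forall t, a <= t <= b -> m <= w t <= M.
Proof.
  intros Hab Hc Hr.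
  destruct (continuity_ab_maj w a b Hab) as (x & Hx & Ix);
    [now intros; apply continuity_pt_filterlim, Hc|].
  destruct (continuity_ab_min w a b Hab) as (y & Hy & Iy);
    [now intros; apply continuity_pt_filterlim, Hc|].
  exists (w y), (w x); repeat split; try apply Hr; auto.
Qed.

Lemma second_order_unique_forward (A B : Rbar) (G w1 p1 w2 p2 : R -> R) (t0 t1 : R) :
  (forall y, Rbar_open_interval A B y -> ex_derive G y /\ continuous (Derive G) y) ->
  (forall t, Rbar_open_interval A B (w1 t)) ->
  (forall t, Rbar_open_interval A B (w2 t)) ->
  (forall t, is_derive w1 t (p1 t)) -> (forall t, is_derive p1 t (G (w1 t))) ->
  (forall t, is_derive w2 t (p2 t)) -> (forall t, is_derive p2 t (G (w2 t))) ->
  w1 t0 = w2 t0 -> p1 t0 = p2 t0 -> t0 <= t1 -> w1 t1 = w2 t1.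
Proof.
  intros HG R1 R2 D1 D1' D2 D2' E0 E0' Ht.
  destruct (continuous_range_segment w1 A B t0 t1 Ht) as (m1 & M1 & A1 & B1 & I1); auto.
  { intros t _; exact (is_derive_continuous _ _ _ (D1 t)). }
  destruct (continuous_range_segment w2 A B t0 t1 Ht) as (m2 & M2 & A2 & B2 & I2); auto.
  { intros t _; exact (is_derive_continuous _ _ _ (D2 t)). }
  set (m := Rmin m1 m2); set (M := Rmax M1 M2).
  assert (Hmid : forall y, m <= y <= M -> Rbar_open_interval A B y).
  { intros y [Hy1 Hy2]; split.
    - apply Rbar_lt_le_trans with m; [|exact Hy1].
      exact (Rmin_case m1 m2 (fun x => Rbar_lt A x) A1 A2).
    - apply Rbar_le_lt_trans with M; [exact Hy2|].
      exact (Rmax_case M1 M2 (fun x => Rbar_lt x B) B1 B2). }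
  assert (J : forall t, t0 <= t <= t1 -> m <= w1 t <= M /\ m <= w2 t <= M).
  { intros t H; specialize (I1 t H); specialize (I2 t H); unfold m, M.
    pose proof (Rmin_l m1 m2); pose proof (Rmin_r m1 m2).
    pose proof (Rmax_l M1 M2); pose proof (Rmax_r M1 M2); lra. }
  assert (HmM : m <= M) by (specialize (J t0 ltac:(lra)); lra).
  destruct (bounded_on_segment (Derive G) m M HmM) as [L HL].
  { intros y Hy; apply HG, Hmid, Hy. }
  assert (Lip : forall x y, m <= x <= M -> m <= y <= M ->
            Rabs (G x - G y) <= L * Rabs (x - y)).
  { assert (K : forall x y, m <= x <= M -> m <= y <= M -> x <= y ->
            Rabs (G x - G y) <= L * Rabs (x - y)).
    { intros x y Hx Hy Hxy.
      destruct (mean_value G (Derive G) x y Hxy) as (c & Hc & Ec).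
      { intros z Hz; apply Derive_correct, HG, Hmid; lra. }
      rewrite <- Rabs_Ropp, Ropp_minus_distr, Ec, Rabs_mult.
      rewrite <- (Rabs_Ropp (x - y)), Ropp_minus_distr.
      apply Rmult_le_compat_r; [apply Rabs_pos|apply HL; lra]. }
    intros x y Hx Hy; destruct (Rle_dec x y); [auto|].
    rewrite <- Rabs_Ropp, Ropp_minus_distr, <- (Rabs_Ropp (x - y)), Ropp_minus_distr.
    apply K; lra. }
  set (d := fun t => w1 t - w2 t); set (d' := fun t => p1 t - p2 t).
  assert (Z : d t1 ^ 2 + d' t1 ^ 2 = 0).
  (* The squared distance in phase space. Its derivative is at most
     [2 * (1 + L) * Rabs (d t) * Rabs (d' t)], hence at most [1 + L] times the distance squared. *)
  { apply (gronwall_zero (fun t => d t ^ 2 + d' t ^ 2)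
      (fun t => 2 * d t * d' t + 2 * d' t * (G (w1 t) - G (w2 t))) (1 + L) t0 t1 Ht).
    - intros t _.
      assert (Hd : is_derive d t (d' t)) by (apply (is_derive_minus w1 w2); auto).
      assert (Hd' : is_derive d' t (G (w1 t) - G (w2 t)))
        by (apply (is_derive_minus p1 p2); auto).
      evar_last; [auto_derive; [split; [now exists (d' t)|split; [|exact I]];
        now exists (G (w1 t) - G (w2 t))|reflexivity]|].
      rewrite_derive Hd; rewrite_derive Hd'; ring.
    - intros t H; destruct (J t H) as [J1 J2].
      specialize (Lip _ _ J1 J2); fold (d t) in Lip.
      assert (HL0 : 0 <= L) by
        (eapply Rle_trans; [apply Rabs_pos|apply (HL m); lra]).
      assert (K : d' t * (G (w1 t) - G (w2 t)) <= Rabs (d' t) * (L * Rabs (d t))).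
      { eapply Rle_trans; [apply Rle_abs|]; rewrite Rabs_mult.
        apply Rmult_le_compat_l; [apply Rabs_pos|exact Lip]. }
      rewrite <- (pow2_abs (d t)), <- (pow2_abs (d' t)).
      assert (K' : d t * d' t <= Rabs (d t) * Rabs (d' t))
        by (rewrite <- Rabs_mult; apply Rle_abs).
      pose proof (pow2_ge_0 (Rabs (d t) - Rabs (d' t))).
      nra.
    - nra.
    - unfold d, d'; rewrite E0, E0'; ring. }
  assert (d t1 = 0) by nra.
  unfold d in *; lra.
Qed.

Lemma is_derive_reflect (w : R -> R) (t l : R) :
  is_derive w (- t) l -> is_derive (fun s : R => w (- s)) t (- l).
Proof.
  intros H.
  evar_last; [auto_derive; [now exists l|reflexivity]|].
  rewrite_derive H; ring.
Qed.

Lemma is_derive_translate (w : R -> R) (c t l : R) :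
  is_derive w (t + c) l -> is_derive (fun s : R => w (s + c)) t l.
Proof.
  intros H.
  evar_last; [auto_derive; [now exists l|reflexivity]|].
  rewrite_derive H; ring.
Qed.

(** The equation is invariant under time reversal, so uniqueness backwards is uniqueness forwards
    for the reflected motions, whose velocities change sign. *)
Lemma second_order_unique (A B : Rbar) (G w1 p1 w2 p2 : R -> R) (t0 : R) :
  (forall y, Rbar_open_interval A B y -> ex_derive G y /\ continuous (Derive G) y) ->
  (forall t, Rbar_open_interval A B (w1 t)) ->
  (forall t, Rbar_open_interval A B (w2 t)) ->
  (forall t, is_derive w1 t (p1 t)) -> (forall t, is_derive p1 t (G (w1 t))) ->
  (forall t, is_derive w2 t (p2 t)) -> (forall t, is_derive p2 t (G (w2 t))) ->
  w1 t0 = w2 t0 -> p1 t0 = p2 t0 -> forall t, w1 t = w2 t.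
Proof.
  intros HG R1 R2 D1 D1' D2 D2' E0 E0' t.
  destruct (Rle_dec t0 t).
  { eapply second_order_unique_forward with (w1 := w1) (w2 := w2); eauto. }
  rewrite <- (Ropp_involutive t).
  apply (second_order_unique_forward A B G
    (fun t => w1 (- t)) (fun t => - p1 (- t))
    (fun t => w2 (- t)) (fun t => - p2 (- t)) (- t0) (- t)); auto;
    rewrite ?Ropp_involutive; try congruence; try lra.
  - intros s; apply is_derive_reflect, D1.
  - intros s; rewrite <- (Ropp_involutive (G _)).
    apply (is_derive_opp (fun t => p1 (- t))), is_derive_reflect, D1'.
  - intros s; apply is_derive_reflect, D2.
  - intros s; rewrite <- (Ropp_involutive (G _)).
    apply (is_derive_opp (fun t => p2 (- t))), is_derive_reflect, D2'.
Qed.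

(* With [D = s'' - F'(s) / 2], differentiating the equation gives [s' D = 0].
   Where [D <> 0], [s] is locally the constant [e], so [D = - F'(e) / 2] there;
   being continuous with values in [{0, - F'(e) / 2}], [D] is constant. *)
Lemma nonconstant_second_order (F s : R -> R) (e : R) :
  smooth s -> nonconstant s ->
  (forall t, ex_derive F (s t)) -> (forall t, continuous (Derive F) (s t)) ->
  (forall t, Derive s t ^ 2 = F (s t)) ->
  (forall t, F (s t) = 0 -> s t = e) -> Derive F e <> 0 ->
  forall t, is_derive (Derive s) t (Derive F (s t) / 2).
Proof.
  intros Hs [a [b Hab]] HF CF Eq Hz He.
  assert (S1 : forall t, ex_derive s t) by (intro t; exact (Hs 1%nat t I)).
  assert (S2 : forall t, ex_derive (Derive s) t) by (intro t; exact (Hs 2%nat t I)).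
  assert (S3 : forall t, continuous (Derive (Derive s)) t).
  { intro t; apply (ex_derive_continuous (Derive (Derive s))); exact (Hs 3%nat t I). }
  set (D := fun t => Derive (Derive s) t - Derive F (s t) / 2).
  assert (CD : forall t, continuous D t).
  { intro t; unfold D, Rdiv.
    apply (continuous_minus (Derive (Derive s)) (fun t => Derive F (s t) * / 2)); [apply S3|].
    apply (continuous_mult (fun t => Derive F (s t)) (fun _ => / 2)); [|apply continuous_const].
    apply (continuous_comp s (Derive F)); [|apply CF].
    exact (is_derive_continuous _ _ _ (Derive_correct _ _ (S1 t))). }
  assert (sD : forall t, Derive s t * D t = 0).
  { intro t.
    assert (K1 : is_derive (fun t => Derive s t ^ 2) t (2 * Derive s t * Derive (Derive s) t)).
    { evar_last; [auto_derive; [apply S2|reflexivity]|]. change (Derive (fun x => Derive s x) t) with (Derive (Derive s) t); simpl; ring. }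
    assert (K2 : is_derive (fun t => Derive s t ^ 2) t (Derive s t * Derive F (s t))).
    { apply is_derive_ext with (fun t => F (s t)); [intro; now rewrite Eq|].
      apply (is_derive_comp F s); apply Derive_correct; auto. }
    pose proof (is_derive_unique _ _ _ K1); pose proof (is_derive_unique _ _ _ K2).
    unfold D; lra. }
  assert (Dval : forall t, D t = 0 \/ D t = - Derive F e / 2).
  { intro t; destruct (Req_dec (D t) 0) as [|N]; [now left|right].
    assert (L : locally t (fun x => Derive s x = 0)).
    { assert (L : locally t (fun x => D x <> 0)).
      { apply (CD t (fun y => y <> 0)).
        exact (open_neq 0 (D t) N). }
      apply filter_imp with (2 := L); intros x Hx.
      destruct (Rmult_integral _ _ (sD x)); tauto. }
    pose proof (locally_singleton _ _ L) as L0.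
    assert (Derive (Derive s) t = 0).
    { rewrite (Derive_ext_loc _ (fun _ => 0) t L); apply Derive_const. }
    assert (s t = e) by (apply Hz; rewrite <- Eq, L0; ring).
    unfold D; rewrite H, H0; lra. }
  (* The value [- Derive F e / 4] lies strictly between the two that [D] can take; the sign of
     [Derive F e] only decides in which order the intermediate value theorem is applied. *)
  assert (Dsame : forall x y, D x = 0 -> D y = 0).
  { intros x y Zx; destruct (Dval y) as [|Ny]; [assumption|exfalso].
    destruct (Rle_dec 0 (- Derive F e / 2)).
    - destruct (intermediate_value_global D x y (- Derive F e / 4)) as [c Ec];
        [exact CD|lra|].
      destruct (Dval c); lra.
    - destruct (intermediate_value_global D y x (- Derive F e / 4)) as [c Ec];
        [exact CD|lra|].
      destruct (Dval c); lra. }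
  (* If [D] is nonzero somewhere, it vanishes nowhere; then the velocity is zero throughout and [s]
     is constant. *)
  assert (DZ : forall t, D t = 0).
  { intro t; destruct (Req_dec (D t) 0) as [|N]; [assumption|exfalso; apply Hab].
    apply derive_zero_const; intro x.
    assert (Nx : D x <> 0).
    { intro Zx; now apply N, (Dsame x). }
    destruct (Rmult_integral _ _ (sD x)) as [Z|]; [|tauto].
    rewrite <- Z; now apply Derive_correct. }
  intro t; specialize (DZ t); unfold D in DZ.
  replace (Derive F (s t) / 2) with (Derive (Derive s) t) by lra.
  now apply Derive_correct.
Qed.

(** * Motion from a simple turning point *)

Record turning_point (F : R -> R) (A B : Rbar) (e : R) : Prop := {
  tp_range : Rbar_open_interval A B e;
  tp_smooth : smooth_on (Rbar_open_interval A B) F;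
  tp_zero : F e = 0;
  tp_simple : 0 < Derive F e;
  tp_pos : forall y, e < y -> Rbar_lt y B -> 0 < F y;
  (* [Phi] bounds the travel time from below, so that [B] is not reached in
     finite time. *)
  tp_escape : exists Phi dPhi : R -> R,
    (forall y, e < y -> Rbar_lt y B ->
       is_derive Phi y (dPhi y) /\ dPhi y * sqrt (F y) <= 1) /\
    forall M y1, e <= y1 -> Rbar_lt y1 B ->
      exists y, y1 < y /\ Rbar_lt y B /\ M < Phi y
}.

(** With monotonicity, [bounce_onto] yields the limit [B] at infinity; it also provides a time at
    which a given radius is met. *)
Record bounce (F : R -> R) (B : Rbar) (e : R) (r : R -> R) : Prop := {
  bounce_smooth : smooth r;
  bounce_ge : forall t, e <= r t;
  bounce_lt : forall t, Rbar_lt (r t) B;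
  bounce_eq : forall t, Derive r t ^ 2 = F (r t);
  bounce_sym : time_symmetric r;
  bounce_0 : r 0 = e;
  bounce_incr : forall s t, 0 <= s -> s < t -> r s < r t;
  bounce_onto : forall y, e <= y -> Rbar_lt y B -> exists c, 0 <= c /\ r c = y
}.

Lemma open_Rbar_open_interval (A B : Rbar) : open (Rbar_open_interval A B).
Proof. apply open_and; [apply open_Rbar_gt|apply open_Rbar_lt]. Qed.

(** * Derivatives through slope functions *)

(** Carathéodory's form of differentiability. It reduces the derivative rules for inverses, products
    and square roots to algebra with a continuous factor. *)
Lemma is_derive_slope (f : R -> R) (x l : R) :
  is_derive f x l <->
  exists phi : R -> R, phi x = l /\ continuous phi x /\
    forall y : R, f y - f x = phi y * (y - x).
Proof.
  rewrite is_derive_Reals; split.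
  - intros H.
    exists (fun y : R => if Req_EM_T y x then l else (f y - f x) / (y - x)).
    split; [|split].
    + destruct (Req_EM_T x x); [reflexivity|lra].
    + apply filterlim_locally; intros eps.
      destruct (H eps (cond_pos eps)) as [d Hd].
      exists d; intros y Hy.
      destruct (Req_EM_T x x) as [_|]; [|lra].
      destruct (Req_EM_T y x) as [|N]; [apply ball_center|].
      specialize (Hd (y - x) ltac:(lra) Hy).
      rewrite (Rplus_minus x y) in Hd; exact Hd.
    + intros y; destruct (Req_EM_T y x) as [->|N]; [ring|field; lra].
  - intros (phi & E & C & Hphi) eps Heps.
    destruct (proj1 (filterlim_locally phi (phi x)) C (mkposreal eps Heps)) as [d Hd].
    exists d; intros h Hh Hhd.
    rewrite Hphi; replace (x + h - x) with h by ring.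
    replace (phi (x + h) * h / h) with (phi (x + h)) by (field; exact Hh).
    rewrite <- E; apply Hd.
    change (Rabs (x + h - x) < d); now replace (x + h - x) with h by ring.
Qed.

(** If [phi] is the slope function of [T] at [U t], then [s - t = phi (U s) * (U s - U t)], so
    [/ phi (U s)] is the slope function of [U]. *)
Lemma is_derive_inverse (T U : R -> R) (t l : R) :
  l <> 0 -> is_derive T (U t) l -> continuous U t -> (forall s, T (U s) = s) ->
  is_derive U t (/ l).
Proof.
  intros Hl HT HU HTU.
  apply is_derive_slope in HT as (phi & E & C & Hphi).
  (* A zero of [phi (U s)] forces [s = t], where the value is [l]. *)
  assert (nz : forall s, phi (U s) <> 0).
  { intros s Z; specialize (Hphi (U s)); rewrite Z, !HTU in Hphi.
    apply Hl; rewrite <- E, <- Z; do 2 f_equal; lra. }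
  apply is_derive_slope; exists (fun s => / phi (U s)).
  split; [now rewrite E|split].
  - apply continuous_Rinv_comp; [|apply nz].
    now apply continuous_comp.
  - intros s; specialize (Hphi (U s)); rewrite !HTU in Hphi.
    rewrite Hphi; field; apply nz.
Qed.

(** At a zero of [a] the product rule asks only for continuity of [b]. This serves for the velocity
    at the turning time, where the second factor is a square root known to be continuous. *)
Lemma is_derive_mult_zero (a b : R -> R) (t l : R) :
  is_derive a t l -> a t = 0 -> continuous b t ->
  is_derive (fun s => a s * b s) t (l * b t).
Proof.
  intros Ha Za Hb.
  apply is_derive_slope in Ha as (phi & E & C & Hphi).
  apply is_derive_slope; exists (fun s => phi s * b s).
  split; [now rewrite E|split].
  - now apply (continuous_mult phi b).
  - intros s; specialize (Hphi s); rewrite Za in *.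
    replace (a s) with (phi s * (s - t)) by lra; ring.
Qed.

(** Dividing the increment of [p ^ 2] by [p s + p t], which is nonzero near [t], gives the increment
    of [p]. *)
Lemma is_derive_of_square (p : R -> R) (t l : R) :
  continuous p t -> p t <> 0 -> is_derive (fun s => p s ^ 2) t l ->
  is_derive p t (l / (2 * p t)).
Proof.
  intros C N H.
  assert (L : locally t (fun s => p s + p t <> 0)).
  { apply (continuous_plus p (fun _ => p t) t C (continuous_const _ _) (fun y => y <> 0)).
    apply (open_neq 0); unfold plus; simpl; lra. }
  apply is_derive_slope in H as (phi & E & Cphi & Hphi).
  apply is_derive_ext_loc with (fun s => p t + phi s / (p s + p t) * (s - t)).
  { apply filter_imp with (2 := L); intros s Hs; specialize (Hphi s).
    apply Rmult_eq_reg_r with (p s + p t); [|exact Hs].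
    field_simplify; [|exact Hs]; lra. }
  apply is_derive_slope; exists (fun s => phi s / (p s + p t)); split; [|split].
  - rewrite E; f_equal; ring.
  - apply (continuous_mult phi (fun s => / (p s + p t))); [exact Cphi|].
    apply continuous_Rinv_comp; [|lra].
    apply (continuous_plus p (fun _ => p t) t C (continuous_const _ _)).
  - intros s; ring.
Qed.

(** Separation of variables: the travel time [RInt q 0] is strictly increasing, odd and unbounded,
    hence a bijection from [D] onto the line, and [U] is its inverse. The second hypothesis on [D]
    makes it an interval symmetric about 0. The derivative of the travel time is handed to the
    unboundedness hypothesis, where an estimate of the integral will need it. *)
Lemma autonomous_flow (D : R -> Prop) (q : R -> R) :
  open D -> D 0 -> (forall x u, D u -> Rabs x <= Rabs u -> D x) ->
  (forall u, D u -> 0 < q u) -> (forall u, D u -> continuous q u) ->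
  (forall u, q (- u) = q u) ->
  ((forall u, D u -> is_derive (RInt q 0) u (q u)) ->
     forall M, exists u, D u /\ M < RInt q 0 u) ->
  exists U : R -> R,
    (forall t, D (U t)) /\ (forall t, is_derive U t (/ q (U t))) /\
    (forall t, U (- t) = - U t) /\ (forall s t, s < t -> U s < U t) /\
    (forall u, D u -> exists t, U t = u).
Proof.
  intros oD D0 star qpos qcont qeven unbounded.
  set (T := RInt q 0 : R -> R) in *.
  assert (HT : forall u, D u -> is_derive T u (q u)).
  { intros u Du; apply (is_derive_RInt q T 0 u); [|now apply qcont].
    apply filter_imp with (2 := oD u Du); intros b Db.
    apply (RInt_correct q), (ex_RInt_continuous q); intros z Hz.
    apply qcont, (star z b Db).
    revert Hz; unfold Rmin, Rmax, Rabs; repeat destruct Rle_dec;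
      repeat destruct Rcase_abs; lra. }
  specialize (unbounded HT).
  assert (between : forall u w x, D u -> D w -> u <= x <= w -> D x).
  { intros u w x Du Dw Hx.
    destruct (Rle_dec (Rabs x) (Rabs u)) as [H|H]; [now apply (star x u)|].
    apply (star x w Dw); revert H; unfold Rabs; repeat destruct Rcase_abs; lra. }
  assert (Tincr : forall u w, D u -> D w -> u < w -> T u < T w).
  { intros u w Du Dw Huw; apply (derive_pos_lt T q u w Huw); intros x Hx;
      [apply HT|apply qpos]; now apply (between u w). }
  assert (T0 : T 0 = 0) by (apply (RInt_point 0 q)).
  assert (Dopp : forall u, D u -> D (- u))
    by (intros u Du; apply (star _ u Du); rewrite Rabs_Ropp; lra).
  (* Substitution of [- y] in the integral, with [q] even. *)
  assert (Todd : forall u, D u -> T (- u) = - T u).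
  { intros u Du.
    assert (C : forall b z, D b -> Rmin 0 b <= z <= Rmax 0 b -> continuous q z).
    { intros b z Db Hz; apply qcont, (star z b Db).
      revert Hz; unfold Rmin, Rmax, Rabs; repeat destruct Rle_dec;
        repeat destruct Rcase_abs; lra. }
    pose proof (RInt_comp_lin q (-1) 0 0 u) as E.
    replace (-1 * 0 + 0) with 0 in E by ring.
    replace (-1 * u + 0) with (- u) in E by ring.
    unfold T; rewrite <- E.
    2: { apply (ex_RInt_continuous q); intros z; apply C; auto. }
    rewrite (RInt_ext _ (fun y => opp (q y))).
    2: { intros y _; rewrite <- (qeven y); unfold scal, opp; simpl; unfold mult; simpl.
         replace (-1 * y + 0) with (- y) by ring; ring. }
    apply (RInt_opp q), (ex_RInt_continuous q); intros z; now apply C. }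
  assert (surj : forall t, exists u, D u /\ T u = t).
  { intros t; destruct (unbounded (Rabs t)) as (u & Du & Hu).
    fold T in Hu.
    assert (0 < u).
    { destruct (Rlt_dec 0 u) as [|N]; [assumption|exfalso].
      pose proof (Rabs_pos t).
      destruct (Req_dec u 0) as [->|]; [lra|].
      pose proof (Tincr u 0 Du D0 ltac:(lra)); lra. }
    destruct (intermediate_value T (- u) u t) as (x & Hx & E).
    - lra.
    - intros x Hx; apply (is_derive_continuous T x (q x)), HT.
      now apply (between (- u) u); auto.
    - rewrite Todd by exact Du.
      revert Hu; unfold Rabs; destruct Rcase_abs; lra.
    - exists x; split; [now apply (between (- u) u); auto|exact E]. }
  set (U := fun t => proj1_sig (constructive_indefinite_description _ (surj t))).
  assert (HU : forall t, D (U t) /\ T (U t) = t)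
    by (intros t; exact (proj2_sig (constructive_indefinite_description _ (surj t)))).
  assert (inj : forall u w, D u -> D w -> T u <= T w -> u <= w).
  { intros u w Du Dw Huw; destruct (Rle_dec u w); [assumption|].
    pose proof (Tincr w u Dw Du ltac:(lra)); lra. }
  assert (Uincr : forall s t, s < t -> U s < U t).
  { intros s t Hst; destruct (HU s) as [Ds Es], (HU t) as [Dt Et].
    destruct (Rlt_dec (U s) (U t)); [assumption|exfalso].
    destruct (Req_dec (U s) (U t)) as [E|]; [rewrite E in Es; lra|].
    pose proof (Tincr _ _ Dt Ds ltac:(lra)); lra. }
  assert (Ucont : forall t, continuous U t).
  { intros t; apply filterlim_locally; intros eps.
    destruct (HU t) as [Dt Et].
    destruct (oD _ Dt) as [d Hd].
    pose proof (cond_pos d); pose proof (cond_pos eps).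
    (* Halving makes [eta] strictly smaller than [eps] and than the radius of a ball around [U t]
       inside [D], so both [U t - eta] and [U t + eta] have a travel time. *)
    set (eta := Rmin d eps / 2).
    assert (Heta : 0 < eta < d /\ eta < eps).
    { unfold eta; pose proof (Rmin_l d eps); pose proof (Rmin_r d eps).
      assert (0 < Rmin d eps) by (now apply Rmin_case); lra. }
    assert (Dm : D (U t - eta)).
    { apply Hd; change (Rabs (U t - eta - U t) < d).
      replace (U t - eta - U t) with (- eta) by ring.
      rewrite Rabs_Ropp, Rabs_pos_eq; lra. }
    assert (Dp : D (U t + eta)).
    { apply Hd; change (Rabs (U t + eta - U t) < d).
      replace (U t + eta - U t) with eta by ring; rewrite Rabs_pos_eq; lra. }
    pose proof (Tincr _ _ Dm Dt ltac:(lra)); pose proof (Tincr _ _ Dt Dp ltac:(lra)).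
    apply (locally_interval _ t (T (U t - eta)) (T (U t + eta))); simpl; [lra|lra|].
    intros s Hs1 Hs2; destruct (HU s) as [Ds Es].
    pose proof (inj _ _ Dm Ds ltac:(lra)); pose proof (inj _ _ Ds Dp ltac:(lra)).
    change (Rabs (U s - U t) < eps); apply Rabs_def1; lra. }
  exists U; split; [|split; [|split; [|split]]].
  - apply HU.
  - intros t; destruct (HU t) as [Dt Et]; apply (is_derive_inverse T).
    + pose proof (qpos _ Dt); lra.
    + now apply HT.
    + apply Ucont.
    + apply HU.
  - intros t; destruct (HU t) as [Dt Et], (HU (- t)) as [Dn En].
    apply Rle_antisym; apply inj; auto; rewrite Todd by exact Dt; lra.
  - exact Uincr.
  - intros u Du; exists (T u); destruct (HU (T u)) as [Dt Et].
    apply Rle_antisym; apply inj; auto; lra.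
Qed.

(* Near [e] the quotient [F y / (y - e)] is regular, so in the variable [u] with
   [y = e + u^2] the square-root singularity of [dy/dt = sqrt (F y)] is gone. *)
Lemma turning_point_quotient (F : R -> R) (A B : Rbar) (e : R) :
  turning_point F A B e ->
  exists h : R -> R,
    (forall u, F (e + u ^ 2) = u ^ 2 * h u) /\ h 0 = Derive F e /\
    (forall u, h (- u) = h u) /\
    (forall u, Rbar_lt (e + u ^ 2) B -> 0 < h u /\ continuous h u).
Proof.
  intros HF.
  assert (dF : forall y, e <= y -> Rbar_lt y B -> ex_derive F y).
  { intros y Hy HB; apply (tp_smooth _ _ _ _ HF 1%nat y); split; [|exact HB].
    apply Rbar_lt_le_trans with e; [apply HF|exact Hy]. }
  assert (De : is_derive F e (Derive F e)).
  { apply Derive_correct, dF; [lra|apply HF]. }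
  apply is_derive_slope in De as (phi & Ephi & Cphi & Hphi).
  rewrite (tp_zero _ _ _ _ HF) in Hphi.
  assert (phiE : forall y, e <> y -> phi y = F y * / (y - e)).
  { intros y Hy; specialize (Hphi y).
    replace (F y) with (phi y * (y - e)) by lra; field; lra. }
  (* Since [F e = 0], the slope function [phi] at [e] is the quotient [F y / (y - e)] with the value
     [Derive F e] filled in at [e]. *)
  exists (fun u => phi (e + u ^ 2)); repeat split.
  - intros u; specialize (Hphi (e + u ^ 2)); lra.
  - replace (e + 0 ^ 2) with e by ring; exact Ephi.
  - intros u; do 2 f_equal; ring.
  - destruct (Req_dec (u ^ 2) 0) as [Z|N].
    { rewrite Z, Rplus_0_r, Ephi; apply HF. }
    pose proof (pow2_ge_0 u).
    rewrite phiE by lra; apply Rmult_lt_0_compat.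
    + apply HF; [lra|exact H].
    + apply Rinv_0_lt_compat; lra.
  - apply (continuous_comp (fun u => e + u ^ 2) phi).
    { apply (ex_derive_continuous (fun u : R => e + u ^ 2)); now auto_derive. }
    destruct (Req_dec (u ^ 2) 0) as [Z|N]; [now rewrite Z, Rplus_0_r|].
    pose proof (pow2_ge_0 u).
    set (y := e + u ^ 2) in *.
    apply continuous_ext_loc with (fun y => F y * / (y - e)).
    + apply filter_imp with (fun y => e <> y).
      * intros z Hz; symmetry; now apply phiE.
      * apply filter_imp with (fun z => z <> e); [auto|].
        apply (open_neq e); unfold y; lra.
    + apply (continuous_mult F (fun y => / (y - e))).
      * apply (ex_derive_continuous F), dF;
          [unfold y; lra|exact H].
      * apply (ex_derive_continuous (fun y : R => / (y - e))).
        auto_derive; unfold y; lra.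
Qed.

(** With [U' = sqrt (h U) / 2], the curve [r = e + U ^ 2] has velocity [p = U * sqrt (h U)], and
    [p ^ 2 = F r]. It remains to differentiate [p], although [h] is only continuous: away from the
    turning time through [p ^ 2], at the turning time through the zero of [U]. *)
Lemma bounce_exists (F : R -> R) (A B : Rbar) (e : R) :
  turning_point F A B e -> exists r, bounce F B e r.
Proof.
  intros HF.
  destruct (turning_point_quotient F A B e HF) as (h & hF & h0 & heven & Hh).
  set (D := fun u : R => Rbar_lt (e + u ^ 2) B).
  set (q := fun u => 2 * / sqrt (h u)).
  assert (hpos : forall u, D u -> 0 < sqrt (h u))
    by (intros u Du; apply sqrt_lt_R0, Hh, Du).
  assert (star : forall x u, D u -> Rabs x <= Rabs u -> D x).
  { intros x u Du Hx; apply Rbar_le_lt_trans with (2 := Du).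
    change (e + x ^ 2 <= e + u ^ 2).
    apply Rplus_le_compat_l; rewrite <- !Rsqr_pow2; now apply Rsqr_le_abs_1. }
  destruct (autonomous_flow D q) as (U & DU & HU & Uodd & Uincr & Uonto).
  - apply (open_comp (fun u => e + u ^ 2) (fun y => Rbar_lt y B)).
    + intros u _.
      apply (ex_derive_continuous (fun u : R => e + u ^ 2)); now auto_derive.
    + apply open_Rbar_lt.
  - unfold D; replace (e + 0 ^ 2) with e by ring; apply HF.
  - exact star.
  - intros u Du; unfold q; pose proof (Rinv_0_lt_compat _ (hpos u Du)); lra.
  - intros u Du; apply (continuous_mult (fun _ => 2) (fun u => / sqrt (h u)));
      [apply continuous_const|].
    apply continuous_Rinv_comp.
    + apply (continuous_sqrt_comp h), Hh, Du.
    + pose proof (hpos u Du); lra.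
  - intros u; unfold q; now rewrite heven.
  - intros HT M; set (T := RInt q 0 : R -> R) in *.
    destruct (tp_escape _ _ _ _ HF) as (Phi & dPhi & HPhi & esc).
    (* Only a point [y1] strictly beyond [e] is wanted here, since the estimate on [Phi] does not
       extend to [e] itself. *)
    destruct (esc 0 e) as (y1 & Hy1 & By1 & _); [lra|apply HF|].
    destruct (esc (M + Phi y1 - T (sqrt (y1 - e))) y1) as (y & Hy & By & Hlarge);
      [lra|exact By1|].
    assert (S1 : sqrt (y1 - e) ^ 2 = y1 - e) by (apply pow2_sqrt; lra).
    assert (S2 : sqrt (y - e) ^ 2 = y - e) by (apply pow2_sqrt; lra).
    assert (Dy : D (sqrt (y - e))).
    { unfold D; rewrite S2; replace (e + (y - e)) with y by ring; exact By. }
    exists (sqrt (y - e)); split; [exact Dy|].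
    assert (0 < sqrt (y1 - e)) by (apply sqrt_lt_R0; lra).
    assert (sqrt (y1 - e) < sqrt (y - e)) by (apply sqrt_lt_1_alt; lra).
    enough (T (sqrt (y1 - e)) - Phi (e + sqrt (y1 - e) ^ 2) <=
            T (sqrt (y - e)) - Phi (e + sqrt (y - e) ^ 2)) as K.
    { rewrite S1, S2 in K.
      replace (e + (y1 - e)) with y1 in K by ring.
      replace (e + (y - e)) with y in K by ring; lra. }
    (* From [dPhi * sqrt F <= 1] and [sqrt F = u * sqrt (h u)] follows
       [2 * u * dPhi <= 2 / sqrt (h u) = q u]: the travel time grows at least as fast as [Phi]. *)
    apply (derive_nonneg_le (fun u => T u - Phi (e + u ^ 2))
      (fun u => q u - 2 * u * dPhi (e + u ^ 2))); [lra| |].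
    + intros u Hu.
      assert (Du : D u) by (apply (star u _ Dy); rewrite !Rabs_pos_eq; lra).
      apply (is_derive_minus T (fun u => Phi (e + u ^ 2))); [now apply HT|].
      apply (is_derive_comp Phi (fun u => e + u ^ 2)).
      * apply HPhi; [|exact Du]; pose proof (pow_lt u 2 ltac:(lra)); lra.
      * auto_derive; [exact I|ring].
    + intros u Hu.
      assert (Du : D u) by (apply (star u _ Dy); rewrite !Rabs_pos_eq; lra).
      destruct (HPhi (e + u ^ 2)) as [_ P];
        [pose proof (pow_lt u 2 ltac:(lra)); lra|exact Du|].
      rewrite hF, sqrt_mult, sqrt_pow2 in P
        by (try apply pow2_ge_0; try lra; left; apply Hh, Du).
      pose proof (hpos u Du) as Hs.
      unfold q; apply Rmult_le_reg_r with (sqrt (h u)); [exact Hs|].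
      rewrite Rmult_0_l, Rmult_minus_distr_r, Rmult_assoc, Rinv_l by lra.
      lra.
  - assert (U0 : U 0 = 0) by (pose proof (Uodd 0) as E; rewrite Ropp_0 in E; lra).
    set (r := fun t => e + U t ^ 2); set (p := fun t => U t * sqrt (h (U t))).
    assert (Ucont : forall t, continuous U t)
      by (intros t; exact (is_derive_continuous _ _ _ (HU t))).
    assert (Hr : forall t, is_derive r t (p t)).
    { intros t; pose proof (HU t) as Ht.
      evar_last; [unfold r; auto_derive; [now exists (/ q (U t))|reflexivity]|].
      rewrite_derive Ht; unfold q, p; pose proof (hpos _ (DU t)).
      simpl; field; lra. }
    assert (Hp2 : forall t, p t ^ 2 = F (r t)).
    { intros t; unfold p, r; rewrite hF, Rpow_mult_distr, pow2_sqrt; [ring|].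
      left; apply Hh, DU. }
    assert (Rr : forall t, Rbar_open_interval A B (r t)).
    { intros t; split; [|apply DU].
      apply Rbar_lt_le_trans with e; [apply HF|].
      unfold r; simpl; pose proof (pow2_ge_0 (U t)); simpl in *; lra. }
    assert (cs : forall t, continuous (fun t => sqrt (h (U t))) t).
    { intros t; apply (continuous_sqrt_comp (fun t => h (U t))).
      apply (continuous_comp U h); [apply Ucont|apply Hh, DU]. }
    assert (Hp : forall t, is_derive p t (Derive F (r t) / 2)).
    (* At time 0 the derivative of [p] is [U' * sqrt (h 0)], that is [h 0 / 2], which is
       [Derive F e / 2]. *)
    { intros t; destruct (Req_dec t 0) as [->|Nt].
      - evar_last; [apply (is_derive_mult_zero U (fun t => sqrt (h (U t))));
          [apply HU|exact U0|apply cs]|].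
        unfold q, r; rewrite U0; replace (e + 0 ^ 2) with e by ring.
        rewrite <- h0; rewrite <- (sqrt_sqrt (h 0)) at 3.
        + pose proof (hpos _ (DU 0)) as P; rewrite U0 in P; field; lra.
        + left; apply Hh; rewrite <- U0; apply DU.
      - assert (p t <> 0).
        { apply Rmult_integral_contrapositive_currified.
          - intros Z; destruct (Rlt_dec t 0) as [L|L].
            + pose proof (Uincr _ _ L); lra.
            + pose proof (Uincr 0 t ltac:(lra)); lra.
          - pose proof (hpos _ (DU t)); lra. }
        replace (Derive F (r t) / 2) with (p t * Derive F (r t) / (2 * p t))
          by (field; assumption).
        apply is_derive_of_square; [|assumption|].
        + apply (continuous_mult U (fun t => sqrt (h (U t)))); auto.
        + apply is_derive_ext with (fun t => F (r t)); [intro; now rewrite Hp2|].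
          apply (is_derive_comp F r); [|apply Hr].
          apply Derive_correct, (tp_smooth _ _ _ _ HF 1%nat), Rr. }
    exists r; constructor.
    + apply (second_order_solution_smooth (Rbar_open_interval A B)
        (fun y => Derive F y / 2) r p); auto.
      intros n y Hy; apply ex_derive_n_scal_r.
      exact (smooth_on_Derive _ _ (tp_smooth _ _ _ _ HF) n y Hy).
    + intros t; unfold r; pose proof (pow2_ge_0 (U t)); lra.
    + exact DU.
    + intros t; rewrite (is_derive_unique _ _ _ (Hr t)); apply Hp2.
    + intros t; unfold r; rewrite Uodd; ring.
    + unfold r; rewrite U0; ring.
    + intros s t Hs Hst; unfold r.
      assert (0 <= U s).
      { destruct (Req_dec s 0) as [->|]; [lra|].
        pose proof (Uincr 0 s ltac:(lra)); lra. }
      pose proof (Uincr s t Hst); nra.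
    + intros y Hy By.
      assert (S : sqrt (y - e) ^ 2 = y - e) by (apply pow2_sqrt; lra).
      destruct (Uonto (sqrt (y - e))) as [c Hc].
      { unfold D; rewrite S; replace (e + (y - e)) with y by ring; exact By. }
      exists c; split.
      * destruct (Rle_dec 0 c); [assumption|].
        pose proof (Uincr c 0 ltac:(lra)); pose proof (sqrt_pos (y - e)); lra.
      * unfold r; rewrite Hc, S; ring.
Qed.

(** * Solutions up to time-translation *)

Lemma smooth_on_ex_derive (D : R -> Prop) (f : R -> R) (x : R) :
  smooth_on D f -> D x -> ex_derive f x.
Proof. intros H Dx; exact (H 1%nat x Dx). Qed.

Lemma smooth_on_continuous_Derive (D : R -> Prop) (f : R -> R) (x : R) :
  smooth_on D f -> D x -> continuous (Derive f) x.
Proof.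
  intros H Dx; apply (ex_derive_continuous (Derive f)); exact (H 2%nat x Dx).
Qed.

(** Position and velocity of [s] at one instant are matched by [r] at some time; the translation is
    the difference of the two times. *)
Lemma bounce_classification (F : R -> R) (A B : Rbar) (e : R) (r s : R -> R) :
  turning_point F A B e -> bounce F B e r ->
  smooth s -> nonconstant s -> (forall t, e <= s t) ->
  (forall t, Rbar_lt (s t) B) -> (forall t, Derive s t ^ 2 = F (s t)) ->
  exists c, s = time_translation c r.
Proof.
  intros HF Hr Ss Ns s_ge s_lt s_eq.
  assert (range : forall y, e <= y -> Rbar_lt y B -> Rbar_open_interval A B y).
  { intros y Hy By; split; [|exact By].
    apply Rbar_lt_le_trans with e; [apply HF|exact Hy]. }
  assert (second : forall w, smooth w -> nonconstant w -> (forall t, e <= w t) ->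
    (forall t, Rbar_lt (w t) B) -> (forall t, Derive w t ^ 2 = F (w t)) ->
    forall t, is_derive (Derive w) t (Derive F (w t) / 2)).
  { intros w Sw Nw w_ge w_lt w_eq; apply nonconstant_second_order with e; auto.
    - intros t; apply (smooth_on_ex_derive _ _ _ (tp_smooth _ _ _ _ HF)); auto.
    - intros t; apply (smooth_on_continuous_Derive _ _ _ (tp_smooth _ _ _ _ HF)); auto.
    - intros t Z; destruct (Req_dec e (w t)) as [|N]; [auto|].
      pose proof (w_ge t).
      pose proof (tp_pos _ _ _ _ HF (w t) ltac:(lra) (w_lt t)); lra.
    - pose proof (tp_simple _ _ _ _ HF); lra. }
  assert (Hr1 : forall t, is_derive r t (Derive r t))
    by (intros t; apply Derive_correct, (bounce_smooth _ _ _ _ Hr 1%nat t I)).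
  assert (Nr : nonconstant r).
  { exists 0, 1; pose proof (bounce_incr _ _ _ _ Hr 0 1); lra. }
  assert (ex1 : exists t1, s t1 <> e).
  { destruct Ns as (a & b & Hab).
    destruct (Req_dec (s a) e) as [Ea|]; [|now exists a].
    exists b; intros Eb; apply Hab; congruence. }
  destruct ex1 as [t1 Ht1].
  destruct (bounce_onto _ _ _ _ Hr (s t1) (s_ge t1) (s_lt t1)) as (c0 & _ & Ec0).
  assert (exc : exists c, r c = s t1 /\ Derive r c = Derive s t1).
  { assert (E : Derive r c0 ^ 2 = Derive s t1 ^ 2)
      by (rewrite s_eq, (bounce_eq _ _ _ _ Hr), Ec0; reflexivity).
    assert (P : (Derive r c0 - Derive s t1) * (Derive r c0 + Derive s t1) = 0) by lra.
    destruct (Rmult_integral _ _ P) as [M|M]; [exists c0; lra|].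
    exists (- c0); rewrite (bounce_sym _ _ _ _ Hr); split; [exact Ec0|].
    assert (D : is_derive r (- c0) (- Derive r c0)).
    { apply is_derive_ext with (fun t => r (- t)); [apply (bounce_sym _ _ _ _ Hr)|].
      apply is_derive_reflect; rewrite Ropp_involutive; apply Hr1. }
    rewrite (is_derive_unique _ _ _ D); lra. }
  destruct exc as (c & Ec & Ec').
  exists (c - t1); apply functional_extensionality.
  apply (second_order_unique A B (fun y => Derive F y / 2) s (Derive s)
    (fun t => r (t + (c - t1))) (fun t => Derive r (t + (c - t1))) t1); auto.
  - assert (SG : smooth_on (Rbar_open_interval A B) (fun y => Derive F y / 2)).
    { intros n y Hy; apply ex_derive_n_scal_r.
      exact (smooth_on_Derive _ _ (tp_smooth _ _ _ _ HF) n y Hy). }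
    intros y Hy; split.
    + exact (smooth_on_ex_derive _ _ y SG Hy).
    + exact (smooth_on_continuous_Derive _ _ y SG Hy).
  - intros t; apply range; apply Hr.
  - intros t; apply Derive_correct, (Ss 1%nat t I).
  - intros t; apply is_derive_translate, Hr1.
  - intros t; apply is_derive_translate, second; apply Hr || exact Nr.
  - rewrite (Rplus_minus t1 c); congruence.
  - rewrite (Rplus_minus t1 c); congruence.
Qed.

Lemma global_solution_translation (f : R -> R) (rH lambda c : R) (s : R -> R) :
  global_solution f rH lambda s ->
  global_solution f rH lambda (time_translation c s).
Proof.
  intros (S & R1 & E); split; [|split].
  - intros n t _; apply (ex_derive_n_comp_trans s n t c), S; exact I.
  - intros t; apply R1.
  - intros t.
    assert (D : Derive (time_translation c s) t = Derive s (t + c)).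
    { apply is_derive_unique, (is_derive_translate s), Derive_correct.
      exact (S 1%nat (t + c) I). }
    rewrite D; apply E.
Qed.

(** A common interface for the inner and the outer region, so that solutions are counted once for
    both: [I] is the range of radii swept by the orbit, [e] the radius at which it turns. *)
Record turning_orbit (f : R -> R) (rH lambda : R) (I : R -> Prop) (e : R)
    (r : R -> R) : Prop := {
  orbit_solution : global_solution f rH lambda r;
  orbit_sym : time_symmetric r;
  orbit_0 : r 0 = e;
  orbit_onto : forall y, I y -> exists c, 0 <= c /\ r c = y;
  orbit_inj : forall s t, 0 <= s -> 0 <= t -> r s = r t -> s = t;
  orbit_complete : forall s, global_solution f rH lambda s -> nonconstant s ->
    I (s 0) -> exists c, s = time_translation c r;
  orbit_nonconstant : forall s, global_solution f rH lambda s ->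
    I (s 0) -> s 0 <> e -> nonconstant s
}.

(** A competitor is a translate of [r] by some [c] with [r c = e = r 0]. Evenness replaces [c] by
    its absolute value, and injectivity gives [c = 0]. *)
Lemma turning_orbit_unique (f : R -> R) (rH lambda : R) (I : R -> Prop) (e : R)
    (r : R -> R) :
  I e -> turning_orbit f rH lambda I e r ->
  unique (fun r => global_solution f rH lambda r /\ nonconstant r /\
                   time_symmetric r /\ r 0 = e) r.
Proof.
  intros Ie [Sr Tr R0 _ inj compl _]; split.
  - repeat split; try apply Sr; try exact Tr; try exact R0.
    exists 0, 1; intros E; apply inj in E; lra.
  - intros s (Ss & Ns & _ & S0).
    destruct (compl s Ss Ns) as [c ->]; [now rewrite S0|].
    assert (Rc : r (Rabs c) = r 0).
    { rewrite R0, <- S0; unfold time_translation, Rabs.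
      rewrite Rplus_0_l; destruct Rcase_abs; [apply Tr|reflexivity]. }
    apply inj in Rc; [|apply Rabs_pos|lra].
    assert (c = 0) as -> by (revert Rc; unfold Rabs; destruct Rcase_abs; lra).
    apply functional_extensionality; intros t; unfold time_translation.
    now rewrite Rplus_0_r.
Qed.

(** The radius [r0] is met by [r] exactly at two opposite times [c] and [- c]; translating by one or
    the other gives the two solutions, which evenness of [r] makes reflections of each other. *)
Lemma turning_orbit_two_solutions (f : R -> R) (rH lambda : R) (I : R -> Prop)
    (e : R) (r : R -> R) (r0 : R) :
  turning_orbit f rH lambda I e r -> I r0 -> r0 <> e ->
  two_solutions f rH lambda r0 r.
Proof.
  intros [Sr Tr R0 onto inj compl nonc] I0 N0.
  destruct (onto r0 I0) as (c & Hc & Ec).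
  assert (c <> 0) by (intros ->; congruence).
  exists (time_translation c r), (time_translation (- c) r).
  split; [|split; [|split; [|split]]].
  - intros E; apply (f_equal (fun w => w c)) in E; unfold time_translation in E.
    rewrite Rplus_opp_r in E; apply inj in E; lra.
  - intros s; split.
    + intros [Ss S0].
      destruct (compl s Ss) as [c' ->]; [apply nonc; congruence|congruence|].
      unfold time_translation in S0; rewrite Rplus_0_l in S0.
      destruct (Rle_dec 0 c') as [P|P].
      * left; f_equal; apply inj; auto; congruence.
      * right; f_equal; rewrite <- (Ropp_involutive c'); f_equal.
        apply inj; [lra|exact Hc|rewrite Tr; congruence].
    + intros [->| ->]; (split; [now apply global_solution_translation|]);
        unfold time_translation; rewrite Rplus_0_l; [exact Ec|now rewrite Tr].
  - apply functional_extensionality; intros t.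
    unfold time_translation, time_reflection; rewrite <- Tr; f_equal; ring.
  - exists c; now left.
  - exists (- c); now left.
Qed.

(** * The photon surface equation *)

Definition photon_rate (f : R -> R) (lambda y : R) : R :=
  f y ^ 2 * (1 - v f y / lambda ^ 2).

Lemma global_solution_photon_rate (f : R -> R) (rH lambda : R) (s : R -> R) :
  0 < rH -> 0 < lambda ^ 2 ->
  global_solution f rH lambda s <->
  smooth s /\ (forall t, rH < s t) /\
  (forall t, Derive s t ^ 2 = photon_rate f lambda (s t)).
Proof.
  intros HrH Hl.
  assert (lambda <> 0) by (intros ->; lra).
  split; intros (S & R1 & E); (split; [exact S|split; [exact R1|]]); intros t;
    specialize (R1 t); rewrite E; unfold photon_rate, v; field; lra.
Qed.

Lemma photon_rate_pos (f : R -> R) (lambda y : R) :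
  0 < lambda ^ 2 -> 0 < f y -> v f y < lambda ^ 2 -> 0 < photon_rate f lambda y.
Proof.
  intros Hl Hf Hv; unfold photon_rate.
  apply Rmult_lt_0_compat; [now apply pow_lt|].
  apply Rlt_0_minus, Rmult_lt_reg_r with (lambda ^ 2); [exact Hl|].
  unfold Rdiv; rewrite Rmult_assoc, Rinv_l; lra.
Qed.

Lemma photon_rate_nonneg_inv (f : R -> R) (lambda y : R) :
  0 < lambda ^ 2 -> 0 < f y -> 0 <= photon_rate f lambda y -> v f y <= lambda ^ 2.
Proof.
  intros Hl Hf Hp; apply Rnot_lt_le; intros Hv; revert Hp.
  apply Rlt_not_le; unfold photon_rate.
  assert (1 < v f y / lambda ^ 2).
  { apply Rmult_lt_reg_r with (lambda ^ 2); [exact Hl|].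
    unfold Rdiv; rewrite Rmult_assoc, Rinv_l; lra. }
  pose proof (pow_lt (f y) 2 Hf); nra.
Qed.

Lemma photon_rate_zero (f : R -> R) (lambda y : R) :
  0 < lambda ^ 2 -> 0 < f y -> (photon_rate f lambda y = 0 <-> v f y = lambda ^ 2).
Proof.
  intros Hl Hf.
  assert (lambda <> 0) by (intros ->; lra).
  split.
  - intros E; unfold photon_rate in E; destruct (Rmult_integral _ _ E) as [Z|Z].
    { pose proof (pow_lt (f y) 2 Hf); lra. }
    replace (v f y) with (v f y / lambda ^ 2 * lambda ^ 2) by (field; assumption).
    replace (v f y / lambda ^ 2) with 1 by lra; ring.
  - intros E; unfold photon_rate; rewrite E; field; assumption.
Qed.

(** The bound [f y] is the coordinate speed of a radial light ray. Both escape estimates rest on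
    it. *)
Lemma sqrt_photon_rate_le (f : R -> R) (lambda y : R) :
  y <> 0 -> 0 < lambda ^ 2 -> 0 < f y -> sqrt (photon_rate f lambda y) <= f y.
Proof.
  intros Hy Hl Hf; rewrite <- (sqrt_pow2 (f y)) by lra.
  apply sqrt_le_1_alt; unfold photon_rate.
  assert (0 < v f y) by (apply Rdiv_lt_0_compat; [exact Hf|now apply pow2_gt_0]).
  assert (0 < v f y / lambda ^ 2) by (now apply Rdiv_lt_0_compat).
  pose proof (pow_lt (f y) 2 Hf); nra.
Qed.

(** On the level set the second factor of the rate vanishes, so the derivative of [f ^ 2] drops out
    and the sign is opposite to that of [Derive (v f) y]. *)
Lemma is_derive_photon_rate (f : R -> R) (lambda y : R) :
  0 < lambda ^ 2 -> ex_derive f y -> ex_derive (v f) y -> v f y = lambda ^ 2 ->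
  is_derive (photon_rate f lambda) y (- (f y ^ 2 / lambda ^ 2) * Derive (v f) y).
Proof.
  intros Hl Hf Hv E.
  apply Derive_correct in Hf; apply Derive_correct in Hv.
  evar_last.
  { unfold photon_rate; auto_derive; [|reflexivity].
    repeat split; [now exists (Derive f y)|now exists (Derive (v f) y)]. }
  change (Derive (fun y => v f y) y) with (Derive (v f) y); rewrite E; simpl in Hl |- *; field.
  intros ->; lra.
Qed.

Lemma smooth_on_mult (D : R -> Prop) (f g : R -> R) :
  open D -> smooth_on D f -> smooth_on D g -> smooth_on D (fun x => f x * g x).
Proof.
  intros oD Hf Hg n x Dx.
  apply (differentiable_upto_mult n D f g oD) with (m := n); auto;
    intros m y _ Dy; auto.
Qed.

Lemma smooth_on_v (D : R -> Prop) (f : R -> R) :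
  open D -> (forall x, D x -> x <> 0) -> smooth_on D f -> smooth_on D (v f).
Proof.
  intros oD nz Hf.
  assert (Hid : smooth_on D (fun x => x))
    by (intros n x Dx; now apply (differentiable_upto_id n D n x)).
  assert (Hinv : smooth_on D (fun x => / x)).
  { intros n x Dx; apply (differentiable_upto_inv n D (fun x => x) oD nz) with (m := n); auto.
    apply differentiable_upto_id. }
  intros n x Dx.
  apply ex_derive_n_ext_loc with (fun y => f y * (/ y * / y)).
  { apply filter_imp with (2 := oD x Dx); intros y Dy; unfold v; field; now apply nz. }
  revert n x Dx; apply smooth_on_mult; auto; now apply smooth_on_mult.
Qed.

Lemma smooth_on_photon_rate (D : R -> Prop) (f : R -> R) (lambda : R) :
  open D -> (forall x, D x -> x <> 0) -> smooth_on D f ->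
  smooth_on D (photon_rate f lambda).
Proof.
  intros oD nz Hf.
  assert (Hv := smooth_on_v D f oD nz Hf).
  intros n x Dx.
  apply ex_derive_n_ext with (fun y => (f y * f y) * (1 - v f y * / lambda ^ 2)).
  { intros y; unfold photon_rate, Rdiv; ring. }
  revert n x Dx; apply smooth_on_mult; [exact oD|now apply smooth_on_mult|].
  intros n x Dx; apply (differentiable_upto_minus n D (fun _ => 1)
    (fun y => v f y * / lambda ^ 2) oD) with (m := n); auto.
  - apply differentiable_upto_const.
  - intros m y _ Dy; now apply ex_derive_n_scal_r, Hv.
Qed.

(** A negative derivative would make the slope function negative near [x], and [f] would fall just
    to the right of [x]. *)
Lemma strictly_increasing_Derive_nonneg (D : R -> Prop) (f : R -> R) (x : R) :
  open D -> D x -> strictly_increasing_on D f -> ex_derive f x -> 0 <= Derive f x.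
Proof.
  intros oD Dx incr Hf; apply Derive_correct in Hf.
  apply is_derive_slope in Hf as (phi & E & C & Hphi).
  apply Rnot_lt_le; intros N.
  assert (L : locally x (fun y => phi y < 0)).
  { apply (C (fun y => y < 0)); apply (open_lt 0); lra. }
  destruct (filter_and _ _ L (oD x Dx)) as [d Hd].
  pose proof (cond_pos d).
  destruct (Hd (x + d / 2)) as [P Dy].
  { change (Rabs (x + d / 2 - x) < d).
    replace (x + d / 2 - x) with (d / 2) by ring; rewrite Rabs_pos_eq; lra. }
  specialize (Hphi (x + d / 2)).
  pose proof (incr x (x + d / 2) Dx Dy ltac:(lra)); nra.
Qed.

Lemma strictly_decreasing_Derive_nonpos (D : R -> Prop) (f : R -> R) (x : R) :
  open D -> D x -> strictly_decreasing_on D f -> ex_derive f x -> Derive f x <= 0.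
Proof.
  intros oD Dx decr Hf.
  enough (0 <= Derive (fun y => - f y) x) by (rewrite Derive_opp in H; lra).
  apply (strictly_increasing_Derive_nonneg D); auto.
  - intros y z Dy Dz Hyz; pose proof (decr y z Dy Dz Hyz); lra.
  - now apply (ex_derive_opp f).
Qed.

(** * Bounds on the metric coefficient at both ends *)

(** The mean value theorem for the extension [g], which vanishes at [rH] and has a bounded
    derivative on the segment. With [f] as a bound for the speed, the horizon is not reached in
    finite time. *)
Lemma horizon_linear_bound (f : R -> R) (rH b : R) :
  C3_extends_to_horizon f rH -> rH < b ->
  exists C, 0 < C /\ forall y, rH < y <= b -> f y <= C * (y - rH).
Proof.
  intros (g & a & Ha & Hgf & [Hg _] & Z & _) Hb.
  assert (range : forall y, rH <= y -> Rbar_open_interval a p_infty y)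
    by (intros y Hy; split; simpl; [lra|exact I]).
  destruct (bounded_on_segment (Derive g) rH b) as [M HM]; [lra| |].
  { intros y Hy; apply (ex_derive_continuous (Derive g)).
    apply (Hg 2%nat y); [lia|apply range; lra]. }
  exists (Rabs M + 1); split; [pose proof (Rabs_pos M); lra|].
  intros y Hy; rewrite <- Hgf by lra.
  destruct (mean_value g (Derive g) rH y) as (c & Hc & E); [lra| |].
  { intros z Hz; apply Derive_correct, (Hg 1%nat z); [lia|apply range; lra]. }
  specialize (HM c ltac:(lra)).
  pose proof (Rle_abs (Derive g c)); pose proof (Rle_abs M).
  rewrite Z in E; nra.
Qed.

Lemma bounded_to_infinity (f : R -> R) (a : R) :
  (forall y, a <= y -> continuous f y) -> is_lim f p_infty 1 ->
  exists K, 0 < K /\ forall y, a <= y -> f y <= K.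
Proof.
  intros Cf Lf.
  apply is_lim_spec in Lf; destruct (Lf (mkposreal 1 Rlt_0_1)) as [X HX]; simpl in HX.
  destruct (bounded_on_segment f a (Rmax a X)) as [M HM].
  { apply Rmax_l. }
  { intros y Hy; apply Cf; lra. }
  (* Beyond [X] the limit gives [f y < 2]; the constant covers both ranges and is positive. *)
  exists (Rabs M + 2); split; [pose proof (Rabs_pos M); lra|].
  intros y Hy; pose proof (Rabs_pos M); destruct (Rle_dec y (Rmax a X)) as [L|L].
  - specialize (HM y (conj Hy L)); pose proof (Rle_abs (f y)); pose proof (Rle_abs M); lra.
  - pose proof (Rmax_r a X); specialize (HX y ltac:(lra)).
    apply Rabs_def2 in HX; lra.
Qed.

Lemma gap_barrier (s : R -> R) (a b t0 : R) :
  (forall t, continuous s t) -> a < b -> (forall t, ~ a < s t < b) -> s t0 <= a ->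
  forall t, s t <= a.
Proof.
  intros Cs Hab gap H0 t; apply Rnot_lt_le; intros Ht.
  (* The target lies strictly inside the gap and does not exceed [s t]. *)
  destruct (intermediate_value_global s t0 t (Rmin (s t) ((a + b) / 2))) as [x Hx].
  - exact Cs.
  - split; [apply Rmin_glb|apply Rmin_l]; lra.
  - apply (gap x); rewrite Hx; split; [apply Rmin_glb_lt; lra|].
    pose proof (Rmin_r (s t) ((a + b) / 2)); lra.
Qed.

Lemma not_nonconstant (s : R -> R) : ~ nonconstant s -> forall t, Derive s t = 0.
Proof.
  intros N t; rewrite (Derive_ext s (fun _ => s t)); [apply Derive_const|].
  intros x; apply NNPP; intros E; apply N; now exists x, t.
Qed.

Lemma is_lim_even (r : R -> R) (l : Rbar) :
  time_symmetric r -> is_lim r p_infty l -> is_lim r m_infty l.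
Proof.
  intros Tr Hr; apply is_lim_ext with (fun t => r (- t)); [exact Tr|].
  apply (is_lim_comp r Ropp m_infty l p_infty); [exact Hr| |].
  - apply (is_lim_opp (fun x => x) m_infty m_infty), is_lim_id.
  - exists 0; intros x _; discriminate.
Qed.

Lemma bounce_lim (F : R -> R) (B : Rbar) (e : R) (r : R -> R) :
  bounce F B e r -> is_lim r p_infty B.
Proof.
  intros Hr; pose proof (bounce_lt _ _ _ _ Hr) as Lt.
  assert (K : forall y : R, Rbar_lt y B -> exists M : R, forall t, M < t -> y < r t).
  (* Only levels from [e] upwards are attained, hence the maximum; past the time [c] monotonicity
     keeps [r] above the level. *)
  { intros y By; destruct (bounce_onto _ _ _ _ Hr (Rmax e y)) as (c & Hc & Ec).
    - apply Rmax_l.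
    - apply (Rmax_case e y (fun x => Rbar_lt x B)); [|exact By].
      rewrite <- (bounce_0 _ _ _ _ Hr); apply Lt.
    - exists c; intros t Ht.
      pose proof (bounce_incr _ _ _ _ Hr c t Hc Ht); pose proof (Rmax_r e y); lra. }
  apply is_lim_spec; destruct B as [B| |]; simpl in *.
  - intros eps; destruct (K (B - eps)) as [M HM]; [pose proof (cond_pos eps); lra|].
    exists M; intros t Ht; specialize (HM t Ht); specialize (Lt t).
    apply Rabs_def1; pose proof (cond_pos eps); lra.
  - intros M; exact (K M I).
  - destruct (Lt 0).
Qed.

Lemma bounce_inj (F : R -> R) (B : Rbar) (e : R) (r : R -> R) (s t : R) :
  bounce F B e r -> 0 <= s -> 0 <= t -> r s = r t -> s = t.
Proof.
  intros Hr Hs Ht E; destruct (Rtotal_order s t) as [L|[L|L]]; [|exact L|].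
  - pose proof (bounce_incr _ _ _ _ Hr s t Hs L); lra.
  - pose proof (bounce_incr _ _ _ _ Hr t s Ht L); lra.
Qed.

Lemma bounce_incr_pos (F : R -> R) (B : Rbar) (e : R) (r : R -> R) :
  bounce F B e r -> strictly_increasing_on (Rbar_open_interval 0 p_infty) r.
Proof. intros Hr s t [Hs _] _ Hst; simpl in Hs; apply Hr; lra. Qed.

Lemma bounce_decr_neg (F : R -> R) (B : Rbar) (e : R) (r : R -> R) :
  bounce F B e r -> strictly_decreasing_on (Rbar_open_interval m_infty 0) r.
Proof.
  intros Hr s t [_ Hs] [_ Ht] Hst; simpl in Hs, Ht.
  rewrite <- (bounce_sym _ _ _ _ Hr s), <- (bounce_sym _ _ _ _ Hr t).
  apply Hr; lra.
Qed.

(** * The two turning points *)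

(** Monotonicity gives only a weak sign for the derivative of [v f] at [Rl]; regularity of the value
    makes it strict, and the zero of the rate simple. *)
Lemma photon_outer_turning_point (f : R -> R) (rH rstar lambda Rl : R) :
  class_S_ext f rH rstar -> 0 < lambda ^ 2 -> regular_value f rH (lambda ^ 2) ->
  rstar < Rl -> v f Rl = lambda ^ 2 ->
  turning_point (photon_rate f lambda) rH p_infty Rl.
Proof.
  intros (HrH & (_ & _ & Sf & Pf) & _ & Lf & _ & Hrs & _ & _ & decr) Hl Hreg HR ER.
  set (D := Rbar_open_interval rH p_infty) in *.
  assert (oD : open D) by apply open_Rbar_open_interval.
  assert (inD : forall y, rH < y -> D y) by (intros y Hy; split; [exact Hy|exact I]).
  assert (nz : forall y, D y -> y <> 0) by (intros y [Hy _]; simpl in Hy; lra).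
  assert (Hf1 : forall y, D y -> ex_derive f y)
    by (intros y; now apply smooth_on_ex_derive).
  assert (Hv1 : forall y, D y -> ex_derive (v f) y)
    by (intros y; now apply smooth_on_ex_derive, smooth_on_v).
  assert (below : forall y, Rl < y -> v f y < lambda ^ 2).
  { intros y Hy; rewrite <- ER; apply decr; try exact Hy; split; simpl; auto; lra. }
  constructor.
  - apply inD; lra.
  - now apply smooth_on_photon_rate.
  - apply photon_rate_zero; auto; apply Pf, inD; lra.
  - rewrite (is_derive_unique _ _ _ (is_derive_photon_rate f lambda Rl Hl
      (Hf1 Rl (inD Rl ltac:(lra))) (Hv1 Rl (inD Rl ltac:(lra))) ER)).
    assert (Derive (v f) Rl < 0).
    { pose proof (Hreg Rl ltac:(lra) ER).
      enough (Derive (v f) Rl <= 0) by lra.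
      apply (strictly_decreasing_Derive_nonpos (Rbar_open_interval rstar p_infty)).
      + apply open_Rbar_open_interval.
      + split; simpl; auto.
      + exact decr.
      + apply Hv1, inD; lra. }
    assert (0 < f Rl ^ 2 / lambda ^ 2)
      by (apply Rdiv_lt_0_compat; [apply pow_lt, Pf, inD; lra|exact Hl]).
    nra.
  - intros y Hy _; apply photon_rate_pos; auto; apply Pf, inD; lra.
  - destruct (bounded_to_infinity f Rl) as (K & HK & bound); [|exact Lf|].
    { intros y Hy; apply (ex_derive_continuous f), Hf1, inD; lra. }
    (* The speed is at most [f], hence at most [K], so travelling a distance takes at least that
       distance divided by [K]. *)
    exists (fun y => y / K), (fun _ => / K); split.
    + intros y Hy _; split; [auto_derive; [exact I|ring]|].
      apply Rmult_le_reg_l with K; [exact HK|].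
      rewrite <- Rmult_assoc, Rinv_r, Rmult_1_l, Rmult_1_r by lra.
      apply Rle_trans with (f y); [|apply bound; lra].
      apply sqrt_photon_rate_le; [lra|exact Hl|apply Pf, inD; lra].
    + intros M y1 _ _; exists (Rmax (y1 + 1) (M * K + 1)).
      pose proof (Rmax_l (y1 + 1) (M * K + 1)); pose proof (Rmax_r (y1 + 1) (M * K + 1)).
      repeat split; [lra|].
      apply Rmult_lt_reg_r with K; [exact HK|].
      unfold Rdiv; rewrite Rmult_assoc, Rinv_l; lra.
Qed.

(** In the coordinate [y = - r] the motion runs to the right, from [- rl] towards the horizon at
    [- rH]. The reflection also turns the negative derivative of the rate at [rl] into a positive
    one. *)
Lemma photon_inner_turning_point (f : R -> R) (rH rstar lambda rl : R) :
  class_S_ext f rH rstar -> 0 < lambda ^ 2 -> regular_value f rH (lambda ^ 2) ->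
  rH < rl < rstar -> v f rl = lambda ^ 2 ->
  turning_point (fun y => photon_rate f lambda (- y)) m_infty (- rH) (- rl).
Proof.
  intros (HrH & (_ & _ & Sf & Pf) & Hext & _ & _ & Hrs & incr & _ & _) Hl Hreg HR ER.
  set (D := Rbar_open_interval rH p_infty) in *.
  assert (oD : open D) by apply open_Rbar_open_interval.
  assert (inD : forall y, rH < y -> D y) by (intros y Hy; split; [exact Hy|exact I]).
  assert (nz : forall y, D y -> y <> 0) by (intros y [Hy _]; simpl in Hy; lra).
  assert (Hf1 : forall y, D y -> ex_derive f y)
    by (intros y; now apply smooth_on_ex_derive).
  assert (Hv1 : forall y, D y -> ex_derive (v f) y)
    by (intros y; now apply smooth_on_ex_derive, smooth_on_v).
  assert (below : forall y, rH < y < rl -> v f y < lambda ^ 2).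
  { intros y Hy; rewrite <- ER; apply incr; try apply Hy; split; simpl; lra. }
  constructor.
  - split; simpl; [exact I|lra].
  - intros n y [_ Hy]; simpl in Hy; apply ex_derive_n_comp_opp.
    apply filter_imp with D.
    + intros z Dz k _; revert k z Dz; now apply smooth_on_photon_rate.
    + apply oD, inD; lra.
  - rewrite Ropp_involutive; apply photon_rate_zero; auto; apply Pf, inD; lra.
  - assert (Dr : is_derive (photon_rate f lambda) (- - rl)
        (- (f rl ^ 2 / lambda ^ 2) * Derive (v f) rl)).
    { rewrite Ropp_involutive; apply is_derive_photon_rate; auto;
        [apply Hf1|apply Hv1]; apply inD; lra. }
    apply is_derive_reflect in Dr; rewrite (is_derive_unique _ _ _ Dr).
    assert (0 < Derive (v f) rl).
    { pose proof (Hreg rl ltac:(lra) ER).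
      enough (0 <= Derive (v f) rl) by lra.
      apply (strictly_increasing_Derive_nonneg (Rbar_open_interval rH rstar)).
      + apply open_Rbar_open_interval.
      + split; simpl; lra.
      + exact incr.
      + apply Hv1, inD; lra. }
    assert (0 < f rl ^ 2 / lambda ^ 2)
      by (apply Rdiv_lt_0_compat; [apply pow_lt, Pf, inD; lra|exact Hl]).
    nra.
  - intros y Hy HB; simpl in HB; apply photon_rate_pos; auto;
      [apply Pf, inD|apply below]; lra.
  - destruct (horizon_linear_bound f rH rl Hext) as (C & HC & bound); [lra|].
    (* Up to a constant, this is the travel time at speed [C] times the distance from the horizon;
       its logarithm diverges there. *)
    exists (fun y => - ln (- rH - y) / C), (fun y => / (C * (- rH - y))); split.
    + intros y Hy HB; simpl in HB; split; [auto_derive; [lra|field; lra]|].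
      assert (P : 0 < C * (- rH - y)) by (apply Rmult_lt_0_compat; lra).
      apply Rmult_le_reg_l with (C * (- rH - y)); [exact P|].
      rewrite <- Rmult_assoc, Rinv_r, Rmult_1_l, Rmult_1_r by lra.
      apply Rle_trans with (f (- y)).
      * apply sqrt_photon_rate_le; [lra|exact Hl|apply Pf, inD; lra].
      * replace (- rH - y) with (- y - rH) by ring; apply bound; lra.
    + intros M y1 _ HB; simpl in HB.
      (* The distance from the horizon is less than that of [y1], and small enough for [- ln d / C]
         to be at least [M + 1 / C]. *)
      set (d := Rmin ((- rH - y1) / 2) (exp (- (M * C) - 1))).
      assert (Hd : 0 < d) by (apply Rmin_case; [lra|apply exp_pos]).
      assert (d <= (- rH - y1) / 2) by apply Rmin_l.
      exists (- rH - d); repeat split; simpl; [lra|lra|].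
      replace (- rH - (- rH - d)) with d by ring.
      assert (Hln : ln d <= - (M * C) - 1).
      { rewrite <- (ln_exp (- (M * C) - 1)); apply ln_le; [exact Hd|apply Rmin_r]. }
      apply Rmult_lt_reg_r with C; [exact HC|].
      unfold Rdiv; rewrite Rmult_assoc, Rinv_l; lra.
Qed.

(** * The two radii on the level set *)

Lemma class_S_ext_continuous_v (f : R -> R) (rH rstar y : R) :
  class_S_ext f rH rstar -> rH < y -> continuous (v f) y.
Proof.
  intros (HrH & (_ & _ & Sf & _) & _) Hy.
  apply (ex_derive_continuous (v f)).
  apply smooth_on_ex_derive with (Rbar_open_interval rH p_infty); [|split; [exact Hy|exact I]].
  apply smooth_on_v; [apply open_Rbar_open_interval| |exact Sf].
  intros x [Hx _]; simpl in Hx; lra.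
Qed.

Lemma inner_radius_unique (f : R -> R) (rH rstar c : R) :
  class_S_ext f rH rstar -> 0 < c < v f rstar ->
  exists! rl, rH < rl < rstar /\ v f rl = c.
Proof.
  intros Hf Hc; pose proof Hf as (HrH & _ & Hext & _ & _ & Hrs & incr & _).
  destruct (horizon_linear_bound f rH rstar Hext Hrs) as (C & HC & bound).
  assert (HrH2 := pow_lt rH 2 HrH).
  (* At [rH + d] the bound [f <= C * d] and [C * d < c * rH ^ 2] put [v f] below [c]; halving keeps
     both inequalities strict. *)
  set (d := Rmin (rstar - rH) (c * rH ^ 2 / C) / 2).
  assert (P : 0 < c * rH ^ 2 / C)
    by (apply Rdiv_lt_0_compat; [apply Rmult_lt_0_compat; lra|exact HC]).
  assert (Hd : 0 < d /\ d < rstar - rH /\ d < c * rH ^ 2 / C).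
  { unfold d; pose proof (Rmin_l (rstar - rH) (c * rH ^ 2 / C)).
    pose proof (Rmin_r (rstar - rH) (c * rH ^ 2 / C)).
    assert (0 < Rmin (rstar - rH) (c * rH ^ 2 / C)) by (apply Rmin_case; lra); lra. }
  assert (low : v f (rH + d) < c).
  { assert (C * d < c * rH ^ 2).
    { replace (c * rH ^ 2) with (C * (c * rH ^ 2 / C)) by (field; lra).
      apply Rmult_lt_compat_l; lra. }
    specialize (bound (rH + d) ltac:(lra)).
    replace (rH + d - rH) with d in bound by ring.
    assert (0 < (rH + d) ^ 2) by (apply pow_lt; lra).
    unfold v; apply Rmult_lt_reg_r with ((rH + d) ^ 2); [assumption|].
    unfold Rdiv; rewrite Rmult_assoc, Rinv_l, Rmult_1_r by lra.
    assert (c * rH ^ 2 < c * (rH + d) ^ 2) by (apply Rmult_lt_compat_l; nra).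
    lra. }
  destruct (intermediate_value (v f) (rH + d) rstar c) as (x & Hx & Ex); try lra.
  { intros y Hy; apply (class_S_ext_continuous_v f rH rstar); [exact Hf|lra]. }
  assert (x <> rstar) by (intros ->; lra).
  exists x; split; [split; [lra|exact Ex]|].
  intros y [Hy Ey].
  assert (J : forall z, rH < z < rstar -> Rbar_open_interval rH rstar z)
    by (intros z Hz; split; simpl; lra).
  destruct (Rtotal_order x y) as [L|[L|L]]; [|exact L|].
  - pose proof (incr x y (J x ltac:(lra)) (J y Hy) L); lra.
  - pose proof (incr y x (J y Hy) (J x ltac:(lra)) L); lra.
Qed.

Lemma outer_radius_unique (f : R -> R) (rH rstar c : R) :
  class_S_ext f rH rstar -> 0 < c < v f rstar ->
  exists! Rl, rstar < Rl /\ v f Rl = c.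
Proof.
  intros Hf Hc; pose proof Hf as (HrH & (_ & _ & Sf & _) & _ & Lf & _ & Hrs & _ & _ & decr).
  destruct (bounded_to_infinity f rstar) as (K & HK & bound); [|exact Lf|].
  { intros y Hy; apply (ex_derive_continuous f), (smooth_on_ex_derive _ _ _ Sf).
    split; simpl; [lra|exact I]. }
  (* From [b > K / c] and [b > 1] follows [f b <= K < c * b < c * b ^ 2], so [v f] is below [c] at
     [b]. *)
  set (b := Rmax (Rmax 1 rstar) (K / c) + 1).
  assert (Hb : 1 < b /\ rstar < b /\ K / c < b).
  { unfold b; pose proof (Rmax_l (Rmax 1 rstar) (K / c)).
    pose proof (Rmax_r (Rmax 1 rstar) (K / c)).
    pose proof (Rmax_l 1 rstar); pose proof (Rmax_r 1 rstar); lra. }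
  assert (low : v f b < c).
  { specialize (bound b ltac:(lra)).
    assert (K < c * b).
    { replace K with (c * (K / c)) by (field; lra); apply Rmult_lt_compat_l; lra. }
    assert (c * b < c * b ^ 2) by (apply Rmult_lt_compat_l; nra).
    unfold v; apply Rmult_lt_reg_r with (b ^ 2); [apply pow_lt; lra|].
    unfold Rdiv; rewrite Rmult_assoc, Rinv_l, Rmult_1_r; [lra|].
    pose proof (pow_lt b 2); lra. }
  destruct (intermediate_value (fun y => - v f y) rstar b (- c)) as (x & Hx & Ex); try lra.
  { intros y Hy; apply (continuous_opp (v f)).
    apply (class_S_ext_continuous_v f rH rstar); [exact Hf|lra]. }
  assert (x <> rstar) by (intros ->; lra).
  exists x; split; [split; lra|].
  intros y [Hy Ey].
  assert (J : forall z, rstar < z -> Rbar_open_interval rstar p_infty z)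
    by (intros z Hz; split; simpl; [lra|exact I]).
  destruct (Rtotal_order x y) as [L|[L|L]]; [|exact L|].
  - pose proof (decr x y (J x ltac:(lra)) (J y Hy) L); lra.
  - pose proof (decr y x (J y Hy) (J x ltac:(lra)) L); lra.
Qed.

(** * The orbits in the two allowed regions *)

Lemma forbidden_gap (f : R -> R) (rH rstar lambda rl Rl : R) (s : R -> R) :
  class_S_ext f rH rstar -> 0 < lambda ^ 2 < v f rstar ->
  rH < rl < rstar -> v f rl = lambda ^ 2 ->
  rstar < Rl -> v f Rl = lambda ^ 2 ->
  global_solution f rH lambda s -> forall t, ~ rl < s t < Rl.
Proof.
  intros (HrH & (_ & _ & _ & Pf) & _ & _ & _ & _ & incr & _ & decr) Hl Hrl Erl HRl ERl Ss t Hst.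
  apply global_solution_photon_rate in Ss as (_ & Rs & Es); [|exact HrH|apply Hl].
  assert (lambda ^ 2 < v f (s t)).
  { destruct (Rtotal_order (s t) rstar) as [L|[->|L]]; [|apply Hl|].
    - rewrite <- Erl; apply incr; try (split; simpl); lra.
    - rewrite <- ERl; apply decr; try (split; simpl); try exact I; lra. }
  assert (v f (s t) <= lambda ^ 2); [|lra].
  apply photon_rate_nonneg_inv; [lra|apply Pf; split; [apply Rs|exact I]|].
  rewrite <- Es; apply pow2_ge_0.
Qed.

Lemma global_solution_continuous (f : R -> R) (rH lambda : R) (s : R -> R) (t : R) :
  global_solution f rH lambda s -> continuous s t.
Proof.
  intros [S _]; apply (ex_derive_continuous s); exact (S 1%nat t I).
Qed.

(** Along a constant solution the rate vanishes, which confines it to the level set of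
    [lambda ^ 2]. *)
Lemma global_solution_nonconstant (f : R -> R) (rH rstar lambda : R) (s : R -> R) :
  class_S_ext f rH rstar -> 0 < lambda ^ 2 -> global_solution f rH lambda s ->
  v f (s 0) <> lambda ^ 2 -> nonconstant s.
Proof.
  intros (HrH & (_ & _ & _ & Pf) & _) Hl Ss N; apply NNPP; intros C; apply N.
  apply global_solution_photon_rate in Ss as (_ & Rs & Es); [|exact HrH|exact Hl].
  apply photon_rate_zero; [exact Hl|apply Pf; split; [apply Rs|exact I]|].
  rewrite <- Es, (not_nonconstant s C 0); ring.
Qed.

Lemma outer_turning_orbit (f : R -> R) (rH rstar lambda rl Rl : R) (r : R -> R) :
  class_S_ext f rH rstar -> 0 < lambda ^ 2 < v f rstar ->
  regular_value f rH (lambda ^ 2) ->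
  rH < rl < rstar -> v f rl = lambda ^ 2 ->
  rstar < Rl -> v f Rl = lambda ^ 2 ->
  bounce (photon_rate f lambda) p_infty Rl r ->
  turning_orbit f rH lambda (fun y => Rl <= y) Rl r.
Proof.
  intros Hf Hl Hreg Hrl Erl HRl ERl Hr.
  pose proof Hf as (HrH & _ & _ & _ & _ & _ & _ & _ & decr).
  assert (TP := photon_outer_turning_point f rH rstar lambda Rl Hf (proj1 Hl) Hreg HRl ERl).
  constructor.
  - apply global_solution_photon_rate; [exact HrH|apply Hl|].
    split; [apply Hr|split; [|apply Hr]].
    intros t; pose proof (bounce_ge _ _ _ _ Hr t); lra.
  - apply Hr.
  - apply Hr.
  - intros y Hy; now apply (bounce_onto _ _ _ _ Hr).
  - intros s t; apply (bounce_inj _ _ _ _ _ _ Hr).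
  - intros s Ss Ns S0.
    assert (s_ge : forall t, Rl <= s t).
    { intros t; apply Ropp_le_cancel.
      (* The barrier bounds from above, so the lower bound [Rl] is obtained for [- s] and the gap
         from [- Rl] to [- rl]. *)
      apply (gap_barrier (fun t => - s t) (- Rl) (- rl) 0); try lra.
      - intros x; apply (continuous_opp s), (global_solution_continuous _ _ _ _ _ Ss).
      - intros x Hx.
        apply (forbidden_gap f rH rstar lambda rl Rl s Hf Hl Hrl Erl HRl ERl Ss x); lra. }
    apply global_solution_photon_rate in Ss as (Sm & _ & Es); [|exact HrH|apply Hl].
    apply (bounce_classification (photon_rate f lambda) rH p_infty Rl); auto.
    intros t; exact I.
  - intros s Ss S0 N; apply (global_solution_nonconstant f rH rstar lambda); auto; [apply Hl|].
    enough (v f (s 0) < v f Rl) by lra.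
    apply decr; try (split; simpl); try exact I; lra.
Qed.

(* The inner region is traversed downwards, so it is treated in the coordinate
   [- r]. *)
Lemma inner_turning_orbit (f : R -> R) (rH rstar lambda rl Rl : R) (r : R -> R) :
  class_S_ext f rH rstar -> 0 < lambda ^ 2 < v f rstar ->
  regular_value f rH (lambda ^ 2) ->
  rH < rl < rstar -> v f rl = lambda ^ 2 ->
  rstar < Rl -> v f Rl = lambda ^ 2 ->
  bounce (fun y => photon_rate f lambda (- y)) (- rH) (- rl) r ->
  turning_orbit f rH lambda (fun y => rH < y <= rl) rl (fun t => - r t).
Proof.
  intros Hf Hl Hreg Hrl Erl HRl ERl Hr.
  pose proof Hf as (HrH & _ & _ & _ & _ & _ & incr & _ & _).
  assert (TP := photon_inner_turning_point f rH rstar lambda rl Hf (proj1 Hl) Hreg Hrl Erl).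
  constructor.
  - apply global_solution_photon_rate; [exact HrH|apply Hl|].
    split; [|split].
    + intros n t _; apply ex_derive_n_opp, (bounce_smooth _ _ _ _ Hr n t I).
    + intros t; pose proof (bounce_lt _ _ _ _ Hr t) as L; simpl in L; lra.
    + intros t; rewrite Derive_opp, <- (bounce_eq _ _ _ _ Hr t); ring.
  - intros t; f_equal; apply Hr.
  - rewrite (bounce_0 _ _ _ _ Hr); ring.
  - intros y Hy; destruct (bounce_onto _ _ _ _ Hr (- y)) as (c & Hc & E); simpl; try lra.
    exists c; split; [exact Hc|lra].
  - intros s t Hs Ht E; apply (bounce_inj _ _ _ _ _ _ Hr Hs Ht); lra.
  - intros s Ss Ns S0.
    assert (s_le : forall t, s t <= rl).
    { apply (gap_barrier s rl Rl 0); try lra.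
      - intros x; apply (global_solution_continuous _ _ _ _ _ Ss).
      - apply (forbidden_gap f rH rstar lambda); auto. }
    apply global_solution_photon_rate in Ss as (Sm & Rs & Es); [|exact HrH|apply Hl].
    destruct (bounce_classification _ _ _ _ r (fun t => - s t) TP Hr) as [c Ec].
    + intros n t _; apply ex_derive_n_opp, (Sm n t I).
    + destruct Ns as (a & b & Hab); exists a, b; lra.
    + intros t; specialize (s_le t); lra.
    + intros t; simpl; specialize (Rs t); lra.
    + intros t; rewrite Derive_opp, Ropp_involutive, <- Es; ring.
    + exists c; apply functional_extensionality; intros t.
      apply (f_equal (fun w => w t)) in Ec; unfold time_translation in *; lra.
  - intros s Ss S0 N; apply (global_solution_nonconstant f rH rstar lambda); auto; [apply Hl|].
    enough (v f (s 0) < v f rl) by lra.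
    apply incr; try (split; simpl); lra.
Qed.

Theorem theorem3p7 (f : R -> R) (rH rstar lambda : R)
    (Hf : class_S_ext f rH rstar)
    (Hlambda : 0 < lambda ^ 2 < v f rstar)
    (Hreg : regular_value f rH (lambda ^ 2)) :
  (exists! rl : R, rH < rl < rstar /\ v f rl = lambda ^ 2) /\
  (exists! Rl : R, rstar < Rl /\ v f Rl = lambda ^ 2) /\
  forall rl Rl : R,
    rH < rl < rstar -> v f rl = lambda ^ 2 ->
    rstar < Rl -> v f Rl = lambda ^ 2 ->
    exists r_in r_out : R -> R,
      unique (fun r => global_solution f rH lambda r /\ nonconstant r /\
                       time_symmetric r /\ r 0 = rl) r_in /\
      unique (fun r => global_solution f rH lambda r /\ nonconstant r /\
                       time_symmetric r /\ r 0 = Rl) r_out /\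
      (forall r0, rH < r0 < rl -> two_solutions f rH lambda r0 r_in) /\
      (forall r0, Rl < r0 -> two_solutions f rH lambda r0 r_out) /\
      (forall (t0 r0 : R) (r : R -> R),
         (global_solution f rH lambda r /\ r t0 = r0) <->
         (exists s, global_solution f rH lambda s /\ s 0 = r0 /\
                    r = time_translation (- t0) s)) /\
      strictly_increasing_on (Rbar_open_interval m_infty 0) r_in /\
      strictly_decreasing_on (Rbar_open_interval 0 p_infty) r_in /\
      is_lim r_in m_infty rH /\ is_lim r_in p_infty rH /\
      strictly_decreasing_on (Rbar_open_interval m_infty 0) r_out /\
      strictly_increasing_on (Rbar_open_interval 0 p_infty) r_out /\
      is_lim r_out m_infty p_infty /\ is_lim r_out p_infty p_infty.
Proof.
  split; [now apply inner_radius_unique|].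
  split; [now apply outer_radius_unique with rH|].
  intros rl Rl Hrl Erl HRl ERl.
  (* Here [r_in] is the motion in the coordinate [- r]; the inner solution is its negative. *)
  destruct (bounce_exists _ _ _ _ (photon_inner_turning_point f rH rstar lambda rl
    Hf (proj1 Hlambda) Hreg Hrl Erl)) as [r_in B_in].
  destruct (bounce_exists _ _ _ _ (photon_outer_turning_point f rH rstar lambda Rl
    Hf (proj1 Hlambda) Hreg HRl ERl)) as [r_out B_out].
  assert (O_in := inner_turning_orbit f rH rstar lambda rl Rl r_in
    Hf Hlambda Hreg Hrl Erl HRl ERl B_in).
  assert (O_out := outer_turning_orbit f rH rstar lambda rl Rl r_out
    Hf Hlambda Hreg Hrl Erl HRl ERl B_out).
  assert (lim_in : is_lim (fun t => - r_in t) p_infty rH).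
  { rewrite <- (Ropp_involutive rH).
    exact (is_lim_opp _ _ _ (bounce_lim _ _ _ _ B_in)). }
  exists (fun t => - r_in t), r_out.
  refine (conj _ (conj _ (conj _ (conj _ (conj _ (conj _ (conj _ (conj _
    (conj _ (conj _ (conj _ (conj _ _)))))))))))).
  - apply (turning_orbit_unique f rH lambda (fun y => rH < y <= rl)); [lra|exact O_in].
  - apply (turning_orbit_unique f rH lambda (fun y => Rl <= y)); [lra|exact O_out].
  - intros r0 Hr0; apply (turning_orbit_two_solutions _ _ _ _ _ _ _ O_in); lra.
  - intros r0 Hr0; apply (turning_orbit_two_solutions _ _ _ _ _ _ _ O_out); lra.
  - intros t0 r0 r; split.
    + intros [Sr E]; exists (time_translation t0 r); split; [|split].
      * now apply global_solution_translation.
      * unfold time_translation; now rewrite Rplus_0_l.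
      * apply functional_extensionality; intros t; unfold time_translation; f_equal; ring.
    + intros (s & Ss & E & ->); split; [now apply global_solution_translation|].
      unfold time_translation; now rewrite Rplus_opp_r.
  - intros x y Dx Dy Hxy; pose proof (bounce_decr_neg _ _ _ _ B_in x y Dx Dy Hxy); lra.
  - intros x y Dx Dy Hxy; pose proof (bounce_incr_pos _ _ _ _ B_in x y Dx Dy Hxy); lra.
  - apply is_lim_even; [apply O_in|exact lim_in].
  - exact lim_in.
  - exact (bounce_decr_neg _ _ _ _ B_out).
  - exact (bounce_incr_pos _ _ _ _ B_out).
  - apply is_lim_even; [apply O_out|exact (bounce_lim _ _ _ _ B_out)].
  - exact (bounce_lim _ _ _ _ B_out).
Qed.
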